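(* Let $G$ be a finite group, let $F$ be an algebraically closed field of characteristic $p>0$, and let $B$ be a block of $FG$ with non-cyclic defect group of order $p^d$. Then $$LL(ZB)\le p^{d-1}+p-1.$$
   Context: A block $B$ of $FG$ is an indecomposable two-sided ideal direct summand of the group algebra $FG$; $ZB$ is its center, a commutative finite-dimensional local $F$-algebra. Defect groups of $B$ are in the usual sense of modular representation theory. For a finite-dimensional $F$-algebra $A$ with Jacobson radical $J(A)$, the Loewy length $LL(A)$ is the smallest integer $n\ge 0$ with $J(A)^n=0$. *)

(* Defs.v *)
From mathcomp Require Import all_boot all_order all_fingroup all_algebra.
From mathcomp Require Import all_solvable all_field all_character.

Set Implicit Arguments.
Unset Strict Implicit.
Unset Printing Implicit Defensive.

Import GRing.Theory.
Local Open Scope ring_scope.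

(* As in mxalgebra and mxrepresentation, a linear subspace of 'M[F]_n (in     *)
(* particular an algebra or an ideal) is given by a matrix A : 'A[F]_n, whose *)
(* row space is that subspace in mxvec encoding; x \in A is (mxvec x <= A)%MS *)
(* and (A * B)%MS is the span of all products. Subspaces are only relevant up *)
(* to (_ :=: _)%MS. Left ideals of a unital algebra are subspaces, so         *)
(* quantifying over 'A[F]_n covers all of them.                               *)

Section Loewy.
Variables (F : fieldType) (n : nat).
Implicit Types A J M N : 'A[F]_n.

Definition maximal_left_ideal A M :=
  [/\ left_mx_ideal A M, (M < A)%MS
    & forall N, left_mx_ideal A N -> (M <= N)%MS -> (N < A)%MS -> (N <= M)%MS].

(* J is a relation argument: an intersection over infinitely many ideals is   *)
(* not computable as a matrix over an abstract field. It determines J up to   *)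
(* (_ :=: _)%MS.                                                              *)
Definition is_jacobson_radical A J :=
  forall x : 'M[F]_n,
    (x \in J)%MS <->
    (x \in A)%MS /\ (forall M, maximal_left_ideal A M -> (x \in M)%MS).

(* The k-th power of an ideal J of A, with J^0 = A.                           *)
Definition ideal_exp A J (k : nat) : 'A[F]_n := iter k (fun I => I * J)%MS A.

Definition is_loewy_length A (l : nat) :=
  exists2 J, is_jacobson_radical A J &
    ideal_exp A J l = 0 /\ (forall k, ideal_exp A J k = 0 -> (l <= k)%N).

End Loewy.

Section Blocks.
Variables (F : fieldType) (gT : finGroupType) (G : {group gT}).
Implicit Types B : 'A[F]_#|G|.

Local Notation FG := (group_ring F G).
Local Notation aG := (regular_repr F G).

Definition ideal_summand B :=
  mx_ideal FG B /\
  exists B', [/\ mx_ideal FG B', mxdirect (B + B') & (B + B' :=: FG)%MS].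

Definition indecomposable_ideal B :=
  B != 0 /\
  forall I1 I2 : 'A[F]_#|G|,
    mx_ideal FG I1 -> mx_ideal FG I2 ->
    mxdirect (I1 + I2) -> (I1 + I2 :=: B)%MS ->
  I1 = 0 \/ I2 = 0.

Definition is_block B := ideal_summand B /\ indecomposable_ideal B.

Definition fixed_by (D : {group gT}) (a : 'M[F]_#|G|) :=
  (a \in FG)%MS /\ (forall x, x \in D -> a *m aG x = aG x *m a).

(* The relative trace from (FG)^D to (FG)^G = Z(FG), for D \subset G: the sum *)
(* of the conjugates x^-1 a x, over representatives x of the right cosets of  *)
(* D in G.                                                                    *)
Definition relative_trace (D : {group gT}) (a : 'M[F]_#|G|) : 'M[F]_#|G| :=
  \sum_(C in rcosets D G) aG (repr C)^-1%g *m a *m aG (repr C).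

Definition block_id_trace_from B (D : {group gT}) :=
  D \subset G /\
  exists2 a, fixed_by D a & mxring_id B (relative_trace D a).

(* A defect group of B is a minimal subgroup D of G such that the identity of *)
(* B is a relative trace from D (Green).                                      *)
Definition is_defect_group B (D : {group gT}) :=
  block_id_trace_from B D /\
  (forall H : {group gT},
     H \subset D -> block_id_trace_from B H -> H :=: D).

End Blocks.

(* Main.v *)
Require Import Defs.
From HB Require Import structures.
From mathcomp Require Import all_boot all_order all_fingroup all_algebra.
From mathcomp Require Import all_solvable all_field all_character.
From mathcomp Require Import zify ring.
From Stdlib Require Import Classical_Prop Classical_Pred_Type.

(** The idempotent e of B is a trace from D, so it is supported on elements g
    whose centralizers have all their p-subgroups G-conjugate into D.  Only this
    support condition on e is used; it survives restriction to centralizers.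

    Let S_j(W) be the annihilator in Z(FH) of the j-th power of the augmentation
    ideal of a central p-subgroup W of H.  A product r of central elements, one
    of which is nilpotent, vanishes as soon as the product of the other factors
    is constant on p-sections; for each p-element v of H this is an identity in
    the center of FC_H(v), obtained by the Brauer homomorphism, and there v - 1
    maps S_j(W) to S_i(W<v>) with i + 1 = j |W<v> : W|.  Induction on W from
    above gives J(ZFH)^n t S_j(W) = 0 for n |W| >= j q, if the p-subgroups of
    the centralizers of the support of t have order at most q.

    The same induction, for a support condition saying that these p-subgroups P
    have order less than q = p^d, or order q with P/W noncyclic, yields
    J(ZFH)^(n+p-1) e S_j(W) = 0 for n p |W| >= j q; the case W = 1, j = 1 is the
    theorem.  The new case is P/W noncyclic and P/W<v> cyclic.  Then v is not in
    the Frattini subgroup of P modulo W, so P has a homomorphism to F killing W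
    and mapping v to 1; its transfers to C_H(v), weighted by class sums, are
    1-cocycles, which define a derivation of Z(FC_H(v)) killing W and mapping
    v - 1 to an idempotent.  Splitting J(Z) along the powers of v - 1 by means of
    this derivation saves the required factor. *)

Set Implicit Arguments.
Unset Strict Implicit.
Unset Printing Implicit Defensive.

Import GroupScope GRing.Theory.
Local Open Scope ring_scope.

(** * Nilpotent elements, and inverses of integers in characteristic p *)

Definition nilp (R : pzRingType) (x : R) := exists n, x ^+ n = 0.

Section Nilpotents.
Variable R : comPzRingType.
Implicit Types x y : R.

Lemma nilpM x y : nilp x -> nilp (x * y).
Proof. by case=> n xn0; exists n; rewrite exprMn xn0 mul0r. Qed.

Lemma nilpD x y : nilp x -> nilp y -> nilp (x + y).
Proof.
case=> m xm0 [n yn0]; exists (m + n)%N; rewrite exprDn big1 // => i _.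
have [le_in|/ltnW le_ni] := leqP i n.
  have -> : (m + n - i = n - i + m)%N by lia.
  by rewrite exprD xm0 mulr0 mul0r mul0rn.
by rewrite -[X in y ^+ X](subnK le_ni) exprD yn0 !mulr0 mul0rn.
Qed.

Lemma nilpN x : nilp x -> nilp (- x).
Proof. by rewrite -mulrN1; apply: nilpM. Qed.

End Nilpotents.

Lemma natr_coprime_inv (R : nzRingType) p m :
  p \in [pchar R] -> coprime p m -> exists u : R, m%:R * u = 1.
Proof.
move=> charR co_pm.
have m_gt0 : (0 < m)%N.
  by case: m co_pm => //; rewrite /coprime gcdn0; case: p charR => [|[|p]] // /pcharf_prime.
case: (egcdnP p m_gt0) => a b def_a _; exists a%:R.
rewrite -natrM mulnC def_a natrD natrM (pcharf0 charR) mulr0 add0r.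
by rewrite gcdnC (eqP co_pm).
Qed.

(** * Derivations and nilpotent products in commutative rings *)

Section Derivation.
Variables (R : comNzRingType) (p : nat) (del : R -> R) (f E : R).
Hypothesis charR : p \in [pchar R].
Hypothesis delD : forall x y, del (x + y) = del x + del y.
Hypothesis delM : forall x y, del (x * y) = del x * y + x * del y.
Hypothesis EE : E * E = E.
Hypothesis delf : del f = E.

Lemma del0 : del 0 = 0.
Proof. by apply: (addrI (del 0)); rewrite -delD !addr0. Qed.

Lemma delN x : del (- x) = - del x.
Proof. by apply/eqP; rewrite -addr_eq0 -delD addNr del0. Qed.

Lemma delE : del E = 0.
Proof.
have d2 : del E = E * del E + E * del E by rewrite -{1}EE delM mulrC.
have: E * del E = 0.
  apply: (addrI (E * del E)); rewrite addr0 {3}d2 mulrDr !mulrA EE //.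
by move=> E0; rewrite d2 E0 addr0.
Qed.

Lemma del_expf n : del (f ^+ n.+1) = n.+1%:R * f ^+ n * E.
Proof.
elim: n => [|n IHn]; first by rewrite expr1 delf expr0 !mul1r.
have -> : n.+2%:R = n.+1%:R + 1 :> R by rewrite natr1.
rewrite [f ^+ n.+2]exprS delM delf IHn exprS.
move: (n.+1%:R) (f ^+ n) => u v; ring.
Qed.

(* The elements of J that are constants of del modulo [f ^+ p.-1]. *)
Let J0 z := nilp z /\ exists w, E * del z = f ^+ p.-1 * w.

(** Integration along f: since [del f = E], subtracting a multiple of [f ^+ m.+1] removes the term
    [f ^+ m * w] from [E * del z], at the cost of dividing by m + 1. This works up to m = p - 2 and
    leaves a multiple of [f ^+ p.-1]. *)
Lemma J0_decomposition z : nilp f -> nilp z -> exists z0 z1, z = z0 + f * z1 /\ J0 z0.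
Proof.
move=> nilf nilz; have p_pr := pcharf_prime charR; have p_gt0 := prime_gt0 p_pr.
have: (p.-1 < p)%N by rewrite prednK.
suff H m : (m < p)%N -> exists z1 w, E * del (z - f * z1) = f ^+ m * w.
  move/H=> [z1 [w def_w]]; exists (z - f * z1), z1; split; first by rewrite subrK.
  split; last by exists w.
  by apply: nilpD => //; apply: nilpN; apply: nilpM.
elim: m => [|m IHm] lt_mp.
  by exists 0, (E * del (z - f * 0)); rewrite expr0 mul1r.
have [z1 [w def_w]] := IHm (ltnW lt_mp).
have co_pm: coprime p m.+1 by rewrite prime_coprime // gtnNdvd.
have [u mu] := natr_coprime_inv charR co_pm.
exists (z1 + f ^+ m * w * u), (- E * del (w * u)).
have -> : z - f * (z1 + f ^+ m * w * u) = (z - f * z1) + - (f ^+ m.+1 * (w * u)).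
  by rewrite exprS; ring.
rewrite delD delN delM del_expf mulrDr def_w.
have Ew : f ^+ m * w = E * (f ^+ m * w) by rewrite -def_w mulrA EE.
transitivity (f ^+ m * w - (m.+1%:R * u) * (E * E) * (f ^+ m * w) + f ^+ m.+1 * (- E * del (w * u))).
  ring.
by rewrite mu EE mul1r -Ew subrr add0r.
Qed.

(** By the Leibniz rule, each summand contains a factor [E * del z], a multiple of [f ^+ p.-1], and
    one factor of the product fewer. The hypothesis ranges over all lists shorter by one, so that
    the induction can move the head of the list into [x]. *)
Lemma del_prod_J0 (ys : seq R) x :
  {in ys, forall z, J0 z} ->
  (forall ys0, (size ys0).+1 = size ys -> {in ys0, forall z, J0 z} ->
     f ^+ p.-1 * (\prod_(z <- ys0) z) * x = 0) ->
  E * del (\prod_(z <- ys) z) * x = 0.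
Proof.
elim: ys x => [|z ys IHys] x Jys Hx.
  rewrite big_nil; suff -> : del 1 = 0 by rewrite mulr0 mul0r.
  by apply: (addrI (del 1)); rewrite addr0 -{3}[1]mulr1 delM mulr1 mul1r.
have [_ [w def_w]] : J0 z by apply: Jys; rewrite mem_head.
have Jys' : {in ys, forall z, J0 z} by move=> y ys_y; apply: Jys; rewrite inE ys_y orbT.
rewrite big_cons delM.
have -> : E * (del z * (\prod_(j <- ys) j) + z * del (\prod_(j <- ys) j)) * x
  = (E * del z) * (\prod_(j <- ys) j) * x + E * del (\prod_(j <- ys) j) * (z * x) by ring.
rewrite IHys ?addr0 //.
  rewrite def_w -[RHS](mulr0 w) -(Hx ys) //; ring.
move=> ys0 sz0 J0ys0; rewrite -[RHS](Hx (z :: ys0)) /= ?sz0 //.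
  by rewrite big_cons; ring.
by move=> y; rewrite inE => /predU1P[->|/J0ys0 //]; apply: Jys; rewrite mem_head.
Qed.

(** In the application f = v - 1, [V] consists of the w - 1 for w in W, [S b] of the elements of FW
    killed by the b-th power of the augmentation ideal of W, and l is p^d divided by the order of
    W<v>. *)
Variables (c l : nat) (S : nat -> R -> Prop) (V : R -> Prop).
Hypothesis c_gt0 : (0 < c)%N.
Hypothesis le_pl : (p <= l)%N.
Hypothesis nilf : nilp f.
Hypothesis S0 : forall k, S 0 k -> k = 0.
Hypothesis SV : forall b k w, V w -> S b.+1 k -> S b (w * k).
Hypothesis delS : forall b k, S b k -> del k = 0.
Hypothesis Vf : V (f ^+ (p ^ c)).
Hypothesis annih : forall (zs : seq R) k, size zs = l -> {in zs, forall z, nilp z} ->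
  f * k = 0 -> (forall w, V w -> w * k = 0) -> (\prod_(z <- zs) z) * k * E = 0.

Lemma expf_S a b k : S b k -> (p ^ c * b <= a)%N -> f ^+ a * k = 0.
Proof.
elim: b a k => [|b IHb] a k Sk; first by rewrite (S0 Sk) mulr0.
rewrite mulnS => le_a.
rewrite -(subnK (leq_trans (leq_addr _ _) le_a)) exprD -mulrA IHb //; first exact: SV.
by rewrite leq_subRL // (leq_trans (leq_addr _ _) le_a).
Qed.

(* For each b, induction on r, and then descent on the exponent of f: applying del
   to [y * f ^+ m.+1 * k * E = 0] gives [y * f ^+ m * k * E = 0] if p does not
   divide m.+1. *)
Lemma prod_J0_annih r ys a b k :
  size ys = (l * r)%N -> {in ys, forall z, J0 z} -> S b k ->
  (p ^ c * b <= a + p * r)%N -> (\prod_(z <- ys) z) * f ^+ a * k * E = 0.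
Proof.
have p_pr := pcharf_prime charR; have p_gt0 := prime_gt0 p_pr.
elim: r ys a b k => [|r IHr] ys a b k.
  by rewrite !muln0 addn0 => _ _ Sk le_a; rewrite -[_ * k]mulrA (expf_S Sk) // mulr0 mul0r.
move=> sz_ys Jys Sk le_a.
(* The first l r factors serve the induction on r, the last l factors serve [annih]. *)
pose ys1 := take (l * r) ys; pose ys2 := drop (l * r) ys.
have def_ys : \prod_(z <- ys) z = (\prod_(z <- ys1) z) * \prod_(z <- ys2) z.
  by rewrite -big_cat /= cat_take_drop.
have sz1 : size ys1 = (l * r)%N by rewrite size_takel // sz_ys mulnS leq_addl.
have sz2 : size ys2 = l by rewrite size_drop sz_ys mulnS addnK.
have J1 : {in ys1, forall z, J0 z} by move=> z /mem_take/Jys.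
have J2 : {in ys2, forall z, J0 z} by move=> z /mem_drop/Jys.
have [le_ra|lt_ar] := leqP (p ^ c * b) (a + p * r).
  rewrite def_ys; have := IHr _ _ _ _ sz1 J1 Sk le_ra => H.
  by rewrite -[RHS](mulr0 (\prod_(z <- ys2) z)) -H; ring.
have def_pc : (p ^ c * b = p * (p ^ c.-1 * b))%N by rewrite mulnA -expnS prednK.
(* Now p^c b = p (s + r + 1): exponents of f from p s + p on are settled by the induction
   hypothesis, and the descent runs from p s + p - 1 to p s. *)
pose s := (p ^ c.-1 * b - r.+1)%N.
have def_s : (p ^ c * b = p * s + p * r + p)%N.
  have: (r < p ^ c.-1 * b)%N.
    by rewrite -(ltn_pmul2l p_gt0) -def_pc (leq_ltn_trans _ lt_ar) // leq_addl.
  by move=> ltr; rewrite def_pc -mulnDr addnC -mulnS /s; congr (p * _)%N; lia.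
have b_gt0 : (0 < b)%N by case: (b) lt_ar => //; rewrite muln0.
suff H t : (t < p)%N -> (\prod_(z <- ys) z) * f ^+ (p * s + (p.-1 - t)) * k * E = 0.
  have le_sa : (p * s <= a)%N by move: le_a def_s; rewrite mulnS; lia.
  have := H p.-1; rewrite subnn addn0 prednK // => /(_ (leqnn _)) H0.
  by rewrite -(subnK le_sa) exprD -[RHS](mulr0 (f ^+ (a - p * s))) -H0; ring.
elim: t => [|t IHt] lt_tp.
  (* By the induction hypothesis for r, the product without [ys2] is killed by one more f, and also
     by [V], which replaces b by b - 1; so [annih] applies. *)
  rewrite subn0; set m := (p * s + p.-1)%N.
  have := @annih ys2 ((\prod_(z <- ys1) z) * f ^+ m * k * E) sz2.
  rewrite def_ys => H; rewrite -[RHS]H.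
  - transitivity ((\prod_(z <- ys1) z * \prod_(z <- ys2) z) * f ^+ m * k * (E * E)); first by rewrite EE.
    ring.
  - by move=> z /J2[].
  - rewrite -[RHS](IHr ys1 m.+1 b k sz1 J1 Sk); first by rewrite exprS; ring.
    by rewrite def_s /m; lia.
  move=> w Vw; have Swk : S b.-1 (w * k) by apply: SV; rewrite // prednK.
  rewrite -[RHS](IHr ys1 m b.-1 _ sz1 J1 Swk); first by ring.
  have: (p ^ c * b = p ^ c * b.-1 + p ^ c)%N by rewrite -mulnSr prednK.
  by have := expn_gt0 p c; rewrite p_gt0 /= => pc0; rewrite /m; lia.
have {}IHt := IHt (ltnW lt_tp).
set m := (p * s + (p.-1 - t.+1))%N.
have def_m : (p * s + (p.-1 - t) = m.+1)%N by rewrite /m; lia.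
rewrite def_m in IHt.
have co_pm : coprime p m.+1.
  rewrite prime_coprime // -def_m dvdn_addr ?dvdn_mulr // gtnNdvd //; lia.
have [u mu] := natr_coprime_inv charR co_pm.
have := congr1 (fun x => u * E * del x) IHt; rewrite del0 mulr0.
rewrite !delM delE (delS Sk) del_expf !mulr0 !addr0 => H.
(* Without one factor at least l r factors remain, and [f ^+ p.-1] lifts the exponent m + 1 > p s to
   at least p s + p, so the induction hypothesis for r applies. *)
have D0 : E * del (\prod_(z <- ys) z) * (f ^+ m.+1 * k * E) = 0.
  apply: del_prod_J0 => // ys0 sz0 Jys0.
  have l_gt0 : (0 < l)%N := leq_trans p_gt0 le_pl.
  have le_sz0 : (l * r <= size ys0)%N by move: sz0; rewrite sz_ys mulnS; lia.
  rewrite -(cat_take_drop (l * r) ys0) big_cat /=.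
  have := IHr (take (l * r) ys0) (p.-1 + m.+1)%N b k.
  rewrite size_takel // => /(_ erefl _ Sk) H0.
  have {}H0 := H0 (fun z Hz => Jys0 z (mem_take Hz)).
  rewrite exprD in H0.
  transitivity ((\prod_(z <- drop (l * r) ys0) z) * 0); last by rewrite mulr0.
  rewrite -H0; first by ring.
  by rewrite def_s; lia.
have : u * (E * del (\prod_(z <- ys) z) * (f ^+ m.+1 * k * E))
   + (m.+1%:R * u) * (E * E * E) * (\prod_(z <- ys) z) * f ^+ m * k = 0.
  by rewrite -H; ring.
rewrite D0 mulr0 add0r mu !EE mul1r => <-; ring.
Qed.

(** Each factor is split as z0 + f z1 with z0 in [J0]. After expansion it either joins the list of
    [J0] factors or raises the exponent of f, so the total count is kept. At the end [prod_J0_annih]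
    applies, with r the number of complete blocks of l factors. *)
Lemma prod_nilp_annih zs j k :
  {in zs, forall z, nilp z} -> S j k -> (p + j * l * p ^ c.-1 <= size zs + 2)%N ->
  (\prod_(z <- zs) z) * (f * k) * E = 0.
Proof.
move=> nilz Sk le_n.
have p_pr := pcharf_prime charR; have p_gt0 := prime_gt0 p_pr.
suff H ys a : {in ys, forall z, J0 z} -> (p + j * l * p ^ c.-1 <= size zs + size ys + a + 2)%N ->
    (\prod_(z <- zs) z) * (\prod_(z <- ys) z) * f ^+ a.+1 * k * E = 0.
  rewrite -[RHS](H [::] 0) // ?addn0 // big_nil expr1; ring.
elim: zs nilz {le_n} ys a => [|z zs IHzs] nilz ys a Jys le_n.
  rewrite big_nil mul1r; rewrite add0n in le_n.
  pose r := (size ys %/ l)%N.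
  have l_gt0 : (0 < l)%N := leq_trans p_gt0 le_pl.
  have le_r : (l * r <= size ys)%N by rewrite mulnC leq_trunc_div.
  have lt_r : (size ys < l * r + l)%N.
    by rewrite mulnC -mulSnr ltn_ceil.
  rewrite -(cat_take_drop (l * r) ys) big_cat /=.
  have H0 : (\prod_(z <- take (l * r) ys) z) * f ^+ a.+1 * k * E = 0.
    apply: (@prod_J0_annih r _ _ j) => //; first by rewrite size_takel.
      by move=> z /mem_take/Jys.
    have -> : (p ^ c * j = p * (p ^ c.-1 * j))%N by rewrite mulnA -expnS prednK.
    have: (p + l * (p ^ c.-1 * j) <= size ys + a + 2)%N by move: le_n; rewrite -mulnA mulnC -mulnA mulnC; lia.
    move: (p ^ c.-1 * j)%N => J le_J.
    have [//|lt_J] := leqP (p * J) (a.+1 + p * r).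
    have lt_rJ : (r < J)%N by rewrite -(ltn_pmul2l p_gt0); lia.
    (* As p <= l, the available bound is weakest for the largest r in this case, r = J - 1, where it
       is just sufficient. *)
    have : ((l - p) * r <= (l - p) * J.-1)%N by rewrite leq_mul2l; apply/orP; right; lia.
    nia.
  transitivity ((\prod_(z <- drop (l * r) ys) z) * 0); last by rewrite mulr0.
  rewrite -H0; ring.
have [z0 [z1 [-> J0z0]]] := J0_decomposition nilf (nilz z (mem_head _ _)).
have nilzs : {in zs, forall z, nilp z} by move=> y zs_y; apply: nilz; rewrite inE zs_y orbT.
have H1 : \prod_(z <- zs) z * \prod_(z <- z0 :: ys) z * f ^+ a.+1 * k * E = 0.
  apply: IHzs => //.
    by move=> y; rewrite inE => /predU1P[->|/Jys].
  by move: le_n => /=; lia.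
have H2 : \prod_(z <- zs) z * \prod_(z <- ys) z * f ^+ a.+2 * k * E = 0.
  by apply: IHzs => //; move: le_n => /=; lia.
rewrite big_cons in H1; rewrite big_cons.
rewrite -[RHS](mulr0 z1) -H2 -[LHS]subr0 -[X in _ - X]H1 [f ^+ a.+2]exprS.
move: (\prod_(z <- zs) z) (\prod_(z <- ys) z) (f ^+ a.+1) => u v w; ring.
Qed.

End Derivation.

(** * Group algebras and their centers *)

Definition galg (F : fieldType) (gT : finGroupType) := {ffun gT -> F^o}.

Section GroupAlgebra.
Variables (F : fieldType) (gT : finGroupType).
Local Notation FG := (galg F gT).
Implicit Types (a b : FG) (g h x : gT) (H : {group gT}).

HB.instance Definition _ := GRing.Lmodule.on FG.

Lemma galgP a b : (forall g, a g = b g) -> a = b.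
Proof. by move/ffunP. Qed.

Definition gone : FG := [ffun g => (g == 1%g)%:R].
Definition gmul a b : FG := [ffun g => \sum_h a h * b (h^-1 * g)%g].

Lemma gmulA : associative gmul.
Proof.
move=> a b c; apply/ffunP=> g; rewrite !ffunE.
transitivity (\sum_h \sum_x a h * (b x * c (x^-1 * (h^-1 * g))%g)).
  by apply: eq_bigr => h _; rewrite ffunE mulr_sumr.
transitivity (\sum_h \sum_x a h * b (h^-1 * x)%g * c (x^-1 * g)%g); last first.
  by rewrite exchange_big; apply: eq_bigr => x _; rewrite ffunE mulr_suml.
apply: eq_bigr => h _; rewrite (reindex_inj (mulgI h^-1%g)).
by apply: eq_bigr => x _; rewrite mulrA invMg invgK -mulgA mulKVg.
Qed.

Lemma gmul1l : left_id gone gmul.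
Proof.
move=> a; apply/ffunP=> g; rewrite ffunE (bigD1 1%g) //= ffunE eqxx mul1r invg1 mul1g.
by rewrite big1 ?addr0 // => h /negPf h1; rewrite ffunE h1 mul0r.
Qed.

Lemma gmul1r : right_id gone gmul.
Proof.
move=> a; apply/ffunP=> g; rewrite ffunE (bigD1 g) //= ffunE mulVg eqxx mulr1.
rewrite big1 ?addr0 // => h hg.
by rewrite ffunE -eq_mulVg1 (negPf hg) mulr0.
Qed.

Lemma gmulDl : left_distributive gmul +%R.
Proof.
move=> a b c; apply/ffunP=> g; rewrite !ffunE -big_split /=.
by apply: eq_bigr => h _; rewrite !ffunE mulrDl.
Qed.

Lemma gmulDr : right_distributive gmul +%R.
Proof.
move=> a b c; apply/ffunP=> g; rewrite !ffunE -big_split /=.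
by apply: eq_bigr => h _; rewrite !ffunE mulrDr.
Qed.

Lemma gone_neq0 : gone != 0.
Proof. by apply/eqP=> /ffunP/(_ 1%g)/eqP; rewrite !ffunE eqxx oner_eq0. Qed.

HB.instance Definition _ := GRing.Zmodule_isNzRing.Build FG
  gmulA gmul1l gmul1r gmulDl gmulDr gone_neq0.

Lemma galg_mulE a b g : (a * b) g = \sum_h a h * b (h^-1 * g)%g.
Proof. by rewrite [LHS]ffunE. Qed.

Lemma galg_scaleAl (c : F) a b : c *: (a * b) = (c *: a) * b.
Proof.
apply: galgP => g; rewrite ffunE !galg_mulE scaler_sumr.
by apply: eq_bigr => h _; rewrite !ffunE scalerAl.
Qed.

Lemma galg_scaleAr (c : F) a b : c *: (a * b) = a * (c *: b).
Proof.
apply: galgP => g; rewrite ffunE !galg_mulE scaler_sumr.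
by apply: eq_bigr => h _; rewrite !ffunE /= /GRing.scale /= mulrCA.
Qed.

HB.instance Definition _ := GRing.Lmodule_isLalgebra.Build F FG galg_scaleAl.
HB.instance Definition _ := GRing.Lalgebra_isAlgebra.Build F FG galg_scaleAr.

Lemma galg_MnE a n g : (a *+ n) g = a g *+ n.
Proof. by elim: n => [|n IHn]; rewrite ?ffunE // !mulrS ffunE IHn. Qed.

Lemma pchar_galg p : p \in [pchar F] -> p \in [pchar FG].
Proof.
move=> charF; rewrite inE (pcharf_prime charF) /=; apply/eqP; apply: galgP => g.
by rewrite galg_MnE !ffunE; apply: mulrn_pchar.
Qed.

Definition gdelta g : FG := [ffun x => (x == g)%:R].

Lemma gdeltaM g h : gdelta g * gdelta h = gdelta (g * h)%g.
Proof.
apply: galgP => x; rewrite galg_mulE (bigD1 g) //= !ffunE eqxx mul1r big1 ?addr0.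
  by rewrite (canF_eq (mulKVg g)).
by move=> y /negPf yg; rewrite ffunE yg mul0r.
Qed.

Lemma gdelta1 : gdelta 1 = 1. Proof. by []. Qed.

Lemma mul_gdelta g a x : (gdelta g * a) x = a (g^-1 * x)%g.
Proof.
rewrite galg_mulE (bigD1 g) //= ffunE eqxx mul1r big1 ?addr0 //.
by move=> y /negPf yg; rewrite ffunE yg mul0r.
Qed.

Lemma mulr_gdelta g a x : (a * gdelta g) x = a (x * g^-1)%g.
Proof.
rewrite galg_mulE (bigD1 (x * g^-1)%g) //= ffunE invMg invgK mulgKV eqxx mulr1 big1 ?addr0 //.
move=> y yg; rewrite ffunE; case: eqP => [def_g|]; last by rewrite mulr0.
by case/eqP: yg; rewrite -def_g invMg invgK mulKVg.
Qed.

Lemma galg_sumE a : a = \sum_g a g *: gdelta g.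
Proof.
apply: galgP => x; rewrite sum_ffunE (bigD1 x) //= !ffunE eqxx /GRing.scale /= mulr1 big1 ?addr0 //.
by move=> y; rewrite eq_sym !ffunE => /negPf->; rewrite /GRing.scale /= mulr0.
Qed.

(* FgT contains FH for all subgroups H of gT; Zgalg H is the center of FH. *)
Definition Zgalg H : pred FG := [pred a : FG |
  [forall g, (a g != 0) ==> (g \in H)] && [forall h in H, forall g, a (g ^ h)%g == a g]].

Lemma ZgalgP H a : reflect ((forall g, g \notin H -> a g = 0) /\
    {in H, forall h g, a (g ^ h)%g = a g}) (a \in Zgalg H).
Proof.
apply: (iffP andP) => [[/forallP suppa /forall_inP fixa]|[suppa fixa]]; split.
- by move=> g Hg; apply: contraNeq Hg => /(implyP (suppa g)).
- by move=> h Hh g; apply/eqP/(forallP (fixa h Hh)).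
- by apply/forallP=> g; apply/implyP; apply: contra_neqT => /suppa.
by apply/forall_inP=> h Hh; apply/forallP=> g; rewrite fixa.
Qed.

Lemma Zgalg_comm H a b : a \in Zgalg H -> (forall g, g \notin H -> b g = 0) -> a * b = b * a.
Proof.
case/ZgalgP=> [suppa fixa] suppb; apply: galgP => g; rewrite !galg_mulE.
rewrite (reindex_inj (h := fun x => g * x^-1)%g); last by move=> x y /mulgI/invg_inj.
apply: eq_bigr => x _; rewrite invMg invgK mulgKV mulrC.
have [Hx|/suppb->] := boolP (x \in H); last by rewrite !mul0r.
by rewrite -(fixa _ Hx (g * x^-1)%g) conjgE mulgKV.
Qed.

Lemma Zgalg_subring_closed H : subring_closed (Zgalg H).
Proof.
split=> [|a b|a b].
- apply/ZgalgP; split=> [g|h _ g]; rewrite !ffunE ?conjg_eq1 //.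
  by have [->|//] := eqVneq g 1%g; rewrite group1.
- case/ZgalgP=> suppa fixa /ZgalgP[suppb fixb]; apply/ZgalgP; split=> [g Hg|h Hh g]; rewrite !ffunE.
    by rewrite suppa ?suppb ?subr0.
  by rewrite fixa ?fixb.
case/ZgalgP=> suppa fixa /ZgalgP[suppb fixb]; apply/ZgalgP; split=> [g Hg|h Hh g]; rewrite !galg_mulE.
  apply: big1 => x _; have [Hx|/suppa->] := boolP (x \in H); last by rewrite mul0r.
  by rewrite suppb ?mulr0 // groupMl ?groupV.
rewrite (reindex_inj (conjg_inj h)); apply: eq_bigr => x _.
by rewrite fixa // -conjVg -conjMg fixb.
Qed.

HB.instance Definition _ H := GRing.isSubringClosed.Build FG (Zgalg H) (Zgalg_subring_closed H).

(** The center is made a ring type of its own, so that the results on commutative rings apply to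
    it. *)
Definition zalg H := {a : FG | a \in Zgalg H}.
HB.instance Definition _ H := SubChoice.on (zalg H).
HB.instance Definition _ H := [SubChoice_isSubNzRing of zalg H by <:].

Lemma zalg_mulC H : @commutative (zalg H) (zalg H) *%R.
Proof.
move=> z t; apply: val_inj; rewrite !rmorphM /=.
by apply: (Zgalg_comm (valP z)); case/ZgalgP: (valP t).
Qed.
HB.instance Definition _ H := GRing.PzRing_hasCommutativeMul.Build (zalg H) (@zalg_mulC H).

Lemma zalg_supp H (z : zalg H) g : g \notin H -> val z g = 0.
Proof. by case/ZgalgP: (valP z) => suppz _ /suppz. Qed.

Lemma zalg_conj H (z : zalg H) h g : h \in H -> val z (g ^ h)%g = val z g.
Proof. by case/ZgalgP: (valP z) => _ fixz /fixz. Qed.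

Lemma pchar_zalg p H : p \in [pchar F] -> p \in [pchar (zalg H)].
Proof.
move=> charF; rewrite inE (pcharf_prime charF) /=; apply/eqP/val_inj.
by rewrite rmorph_nat (pcharf0 (pchar_galg charF)).
Qed.

End GroupAlgebra.

(** * Sums over orbits of p-groups in characteristic p *)

Section PGroupSums.
Variables (F : nzRingType) (p : nat).
Hypothesis charF : p \in [pchar F].

(** Nontrivial orbits have length divisible by p and f is constant on them, so they contribute 0. *)
Lemma sum_pgroup_fix (aT : finGroupType) (rT : finType) (P : {group aT})
    (to : {action aT &-> rT}) (A : {set rT}) (f : rT -> F) :
  p.-group P -> [acts P, on A | to] ->
  {in A & P, forall x a, f (to x a) = f x} ->
  \sum_(x in A) f x = \sum_(x in A | x \in 'Fix_to(P)) f x.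
Proof.
move=> pP actsP fP; rewrite (bigID (mem 'Fix_to(P))) /= -[RHS]addr0; congr (_ + _).
rewrite (eq_bigl (fun x => (x \in A) && (x \notin 'Fix_to(P)))) //.
rewrite big_mkcondr (set_partition_big _ (orbit_partition actsP)) /=.
apply: big1 => _ /imsetP[x Ax ->]; rewrite -big_mkcondr /=.
have [fixx|nfixx] := boolP (x \in 'Fix_to(P)).
  rewrite big_pred0 // => y; move/orbit1P: fixx => o1; rewrite o1 inE.
  by case: eqP => // ->; rewrite /= (introT orbit1P o1).
rewrite (eq_bigl (mem (orbit to P x))); last first.
  move=> y /=; case Oy: (y \in orbit to P x) => //=; apply: contra nfixx => /orbit1P o1.
  by apply/orbit1P; move: Oy; rewrite orbit_sym o1 => /set1P ->; rewrite o1.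
rewrite (eq_bigr (fun=> f x)); last by move=> _ /orbitP[a Pa <-]; rewrite fP.
rewrite sumr_const -mulr_natr.
suff: (p %| #|orbit to P x|)%N by case/dvdnP=> m ->; rewrite natrM (pcharf0 charF) !mulr0.
have pO : p.-nat #|orbit to P x| by rewrite card_orbit (pnat_dvd (dvdn_indexg _ _)).
have [m Om] := p_natP pO; case: m Om => [|m ->]; last by rewrite expnS dvdn_mulr.
rewrite expn0 => /eqP/cards1P[y defO]; case/orbit1P: nfixx.
by have:= orbit_refl to P x; rewrite defO => /set1P->.
Qed.

Lemma sum_perm_fix (T : finType) (s : {perm T}) n (f : T -> F) :
  (s ^+ (p ^ n) = 1)%g -> (forall x, f (s x) = f x) ->
  \sum_x f x = \sum_(x | s x == x) f x.
Proof.
move=> s_pn fs; have p_s : p.-group <[s]>.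
  apply: (@pnat_dvd _ (p ^ n)); first by rewrite -orderE order_dvdn s_pn.
  by rewrite pnatX pnat_id ?(pcharf_prime charF).
have := @sum_pgroup_fix _ _ <[s]>%G ('P)%act [set: T] f p_s.
rewrite (eq_bigl predT) => [-> |x]; last by rewrite inE.
- apply: eq_bigl => x; rewrite inE /=; apply/afixP/eqP=> [/(_ s (cycle_id s))//|sx].
  move=> _ /cycleP[i ->]; elim: i => [|i IHi]; first by rewrite act1.
  by rewrite expgSr actM IHi.
- by apply/subsetP=> a _; rewrite !inE; apply/subsetP=> x _; rewrite !inE.
move=> x _ _ /cycleP[i ->]; elim: i => [|i IHi]; first by rewrite act1.
by rewrite expgSr actM /= /aperm fs.
Qed.

End PGroupSums.

(** * Nilpotent central elements and p-sections *)

Section Reynolds.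
Variables (F : fieldType) (gT : finGroupType) (p : nat).
Hypothesis charF : p \in [pchar F].

(** N is a multiple of the totient of the p'-part m of the group order, so p^N is 1 modulo m and
    fixes p'-parts; it is also large enough for p^N to kill p-parts. The bound K later makes p^N
    exceed a nilpotency exponent. *)
Lemma exists_expg_constt K : exists2 N, (K <= N)%N & forall y : gT, (y ^+ (p ^ N)%N)%g = y.`_p^'.
Proof.
have p_pr := pcharf_prime charF.
set m := (#|[set: gT]|`_p^')%N; set n := #|[set: gT]|.
have m_gt0 : (0 < totient m)%N by rewrite totient_gt0 part_gt0.
exists (totient m * (K + n))%N => [|y].
  by rewrite (leq_trans (leq_addr n K)) // leq_pmull.
have dvd_y : (#[y] %| n)%N by apply: order_dvdG; rewrite inE.
rewrite -{1}(consttC p y) expgMn; last by apply: commuteX2.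
have -> : (y.`_p ^+ (p ^ (totient m * (K + n)))%N = 1)%g.
  apply/eqP; rewrite -order_dvdn order_constt p_part dvdn_exp2l //.
  apply: (@leq_trans n); last by rewrite (leq_trans (leq_addl K n)) // leq_pmull.
  rewrite (leq_trans (ltnW (ltn_logl _ _))) ?order_gt0 // dvdn_leq //.
  by rewrite cardG_gt0.
rewrite mul1g; have ym : (y.`_p^' ^+ m = 1)%g.
  by apply/eqP; rewrite -order_dvdn order_constt partn_dvd // cardG_gt0.
rewrite -(expg_mod _ ym) expnM -modnXm.
have -> : (p ^ totient m = 1 %[mod m])%N.
  apply: Euler_exp_totient; rewrite prime_coprime //.
  apply/negP=> p_m; have := part_pnat p^' n; rewrite -/m => /pnatP.
  by move=> /(_ (part_gt0 _ _) p p_pr p_m); rewrite !inE eqxx.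
by rewrite modnXm exp1n expg_mod ?expg1.
Qed.

Lemma expr_sum_pchar (R : comNzRingType) (I : finType) (f : I -> R) N :
  p \in [pchar R] -> (\sum_i f i) ^+ (p ^ N) = \sum_i f i ^+ (p ^ N).
Proof.
move=> charR; apply: (big_morph (fun x => x ^+ (p ^ N))) => [x y|].
  by apply: exprDn_pchar; rewrite pnatX pnatE ?charR // (pcharf_prime charR).
by rewrite expr0n expn_eq0 -leqn0 leqNgt prime_gt0 ?(pcharf_prime charR).
Qed.

(* Expand the trace [rho] of the q-th power of a, where q is a large power of p:
   the cyclic group of order q permutes the q-tuples of group elements, and only
   the constant tuples contribute. *)
Lemma nilp_fixed_section (H : {group gT}) (a : galg F gT) (rho : gT -> F) :
  nilp a -> (forall g, g \notin H -> a g = 0) ->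
  {in H, forall h g, rho (g ^ h)%g = rho g} ->
  {in H, forall g, rho g = rho (g.`_p^')} ->
  \sum_g a g * rho g = 0.
Proof.
case=> n an0 suppa rhoJ rhoE; have p_pr := pcharf_prime charF.
have [N le_nN pN] := exists_expg_constt n.
have [q def_q] : exists q, (p ^ N = q.+1)%N.
  by exists (p ^ N).-1; rewrite prednK // expn_gt0 prime_gt0.
have aq0 : a ^+ q.+1 = 0.
  rewrite -def_q -(subnKC (leq_trans le_nN (ltnW (ltn_expl N (prime_gt1 p_pr))))).
  by rewrite exprD an0 mul0r.
have expand : a ^+ q.+1 = \sum_(t : {ffun 'I_q.+1 -> gT})
    (\prod_i a (t i)) *: gdelta F (\prod_i t i)%g.
  rewrite -{1}(card_ord q.+1) -prodr_const {1}[a]galg_sumE.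
  rewrite bigA_distr_bigA; apply: eq_bigr => t _.
  elim/big_rec3: _ => [|i g x y _ ->]; first by rewrite scale1r.
  by rewrite /= -scalerAl -scalerAr scalerA gdeltaM.
(* The power of [rho] makes the term of a constant tuple the full power of [a g * rho g], so that
   the Frobenius map can be undone at the end. *)
pose Phi (t : {ffun 'I_q.+1 -> gT}) := (\prod_i a (t i)) * rho (\prod_i t i)%g ^+ q.+1.
pose rot (t : {ffun 'I_q.+1 -> gT}) := [ffun i => t (ordS i)].
have rot_inj : injective rot.
  move=> s t /ffunP eq_st; apply/ffunP=> i; have := eq_st (ord_pred i).
  by rewrite !ffunE ord_predK.
have iter_rot k t i : iter k rot t i = t (iter k (@ordS q.+1) i).
  by elim: k t i => // k IHk t i; rewrite iterS ffunE IHk -iterSr.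
have val_iter k (i : 'I_q.+1) : val (iter k (@ordS q.+1) i) = ((i + k) %% q.+1)%N.
  elim: k => [|k IHk] /=; first by rewrite addn0 modn_small.
  by rewrite /= -/(val _) IHk -addn1 modnDml addn1 addnS.
(* Rotating a tuple conjugates its product by its first entry, which lies in H unless the term is
   0. *)
have PhiS t : Phi (perm rot_inj t) = Phi t.
  rewrite permE /Phi; have -> : \prod_i a (rot t i) = \prod_i a (t i).
    rewrite [RHS](reindex_inj (can_inj (@ordSK q.+1))).
    by apply: eq_bigr => i _; rewrite ffunE.
  have [Ht0|/suppa at0] := boolP (t ord0 \in H); last first.
    by rewrite (bigD1 ord0) //= at0 !mul0r.
  congr (_ * _ ^+ _); rewrite -[RHS](rhoJ _ Ht0); congr rho.
  rewrite big_ord_recr [in RHS]big_ord_recl conjgE -mulgA mulKg; congr (_ * _)%g.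
    apply: eq_bigr => i _; rewrite ffunE; congr (t _); apply: val_inj => /=.
    by rewrite modn_small ?ltnS.
  by rewrite ffunE; congr (t _); apply: val_inj; rewrite /= modnn.
have: \sum_t Phi t = 0.
  transitivity (\sum_g (a ^+ q.+1) g * rho g ^+ q.+1); last first.
    by rewrite aq0 big1 // => g _; rewrite ffunE mul0r.
  rewrite expand; under [RHS]eq_bigr do rewrite sum_ffunE mulr_suml.
  rewrite exchange_big; apply: eq_bigr => t _ /=.
  rewrite (bigD1 (\prod_i t i)%g) //= [X in _ + X]big1 ?addr0 => [|g /negPf gt].
    by rewrite !ffunE eqxx /GRing.scale /= mulr1.
  by rewrite !ffunE gt /GRing.scale /= mulr0 mul0r.
rewrite (@sum_perm_fix _ _ charF _ (perm rot_inj) N) //; last first.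
  apply/permP=> t; rewrite permX (eq_iter (permE _)) perm1 def_q.
  apply/ffunP=> i; rewrite iter_rot; congr (t _); apply: val_inj.
  by rewrite val_iter modnDr modn_small.
rewrite (reindex_onto (fun g : gT => [ffun=> g]) (fun t : {ffun _} => t ord0)) /=; last first.
  move=> t /eqP; rewrite permE => /ffunP fix_t; apply/ffunP=> i; rewrite ffunE.
  case: i => i; elim: i => [|i IHi] lt_i; first by congr (t _); apply: val_inj.
  rewrite (IHi (ltnW lt_i)) -[LHS]fix_t ffunE; congr (t _); apply: val_inj => /=.
  by rewrite modn_small.
rewrite (eq_bigl predT) => [|g]; last first.
  by rewrite ffunE eqxx andbT permE; apply/eqP/ffunP=> i; rewrite !ffunE.
rewrite (eq_bigr (fun g => (a g * rho g) ^+ (p ^ N))) => [|g _].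
  by rewrite -expr_sum_pchar // => /eqP; rewrite expf_eq0 => /andP[_ /eqP].
rewrite def_q /Phi (eq_bigr (fun=> a g)) => [|i _]; last by rewrite ffunE.
rewrite prodr_const card_ord exprMn; have [Hg|/suppa->] := boolP (g \in H); last by rewrite !expr0n !mul0r.
have -> : (\prod_(i < q.+1) [ffun=> g] i = g ^+ q.+1)%g.
  by rewrite (eq_bigr (fun=> g)) => [|i _]; rewrite ?ffunE // prodg_const card_ord.
by rewrite -def_q pN -rhoE.
Qed.

(** The coefficient of [z * r] at g is the sum of a(x) rho(x), where a = g^-1 z is nilpotent because
    z is central, and rho(x) = r(x^-1) is a class function constant on p-sections; so
    [nilp_fixed_section] applies. *)
Theorem mul_nilp_section_constant (H : {group gT}) (z r : zalg F H) :
  nilp z ->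
  (forall v g, v \in H -> p.-elt v -> g \in 'C_H[v] -> val r (v * g)%g = val r g) ->
  z * r = 0.
Proof.
case=> n zn0 r_const; apply: val_inj; rewrite rmorphM rmorph0 /=; apply: galgP => g.
rewrite galg_mulE ffunE; have [Hg|nHg] := boolP (g \in H); last first.
  apply: big1 => h _; have [Hh|/zalg_supp->] := boolP (h \in H); last by rewrite mul0r.
  by rewrite (zalg_supp r) ?mulr0 // groupMl ?groupV.
have := @nilp_fixed_section H (gdelta F g^-1 * val z) (fun x => val r x^-1)%g.
rewrite (reindex_inj (mulgI g^-1%g)) /= => {2}<-.
- apply: eq_bigr => h _; rewrite mul_gdelta invgK mulKVg.
  by rewrite invMg invgK.
- exists n; rewrite exprMn_comm; last first.
    apply/esym; apply: (Zgalg_comm (valP z)) => x; rewrite ffunE.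
    by have [->|//] := eqVneq x g^-1%g; rewrite groupV Hg.
  have -> : val z ^+ n = val (z ^+ n) by rewrite rmorphXn.
  by rewrite zn0 rmorph0 mulr0.
- by move=> x nHx; rewrite mul_gdelta zalg_supp // invgK groupMl.
- by move=> h Hh x /=; rewrite -conjVg zalg_conj.
move=> x Hx; rewrite -{1}(consttC p x) invMg -[RHS](r_const (x.`_p)^-1%g) ?groupV ?p_eltV ?groupX //.
- by rewrite -!invMg; congr (val r _^-1%g); apply: commuteX2.
- by rewrite p_elt_constt.
by rewrite inE Hx cent1C groupV groupX //= cent1id.
Qed.

End Reynolds.

(** * The Brauer homomorphism and annihilators of augmentation powers *)

Section Brauer.
Variables (F : fieldType) (gT : finGroupType) (p : nat).
Hypothesis charF : p \in [pchar F].
Implicit Types (H W : {group gT}) (g v w : gT).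

(** The intended arguments are w in 'Z(H); elsewhere the default 1 is taken. *)
Definition zelt H w : zalg F H := insubd 1 (gdelta F w).

Lemma val_zelt H w : w \in 'Z(H) -> val (zelt H w) = gdelta F w.
Proof.
case/centerP=> Hw cHw; rewrite insubdK //; apply/ZgalgP; split=> [g|h Hh g]; rewrite !ffunE.
  by have [->|//] := eqVneq g w; rewrite Hw.
have -> : (g == w) = (g ^ h == w ^ h)%g by rewrite (inj_eq (conjg_inj h)).
by rewrite [(w ^ h)%g](conjg_fixP _) //; apply/commgP/cHw.
Qed.

Lemma zeltM H : {in 'Z(H) &, {morph zelt H : v w / (v * w)%g >-> v * w}}.
Proof.
by move=> v w Zv Zw; apply: val_inj; rewrite rmorphM /= !val_zelt ?groupM // gdeltaM.
Qed.

Lemma zelt1 H : zelt H 1 = 1.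
Proof. by apply: val_inj; rewrite val_zelt ?group1. Qed.

Lemma zeltX H n w : w \in 'Z(H) -> zelt H (w ^+ n)%g = zelt H w ^+ n.
Proof.
by move=> Zw; elim: n => [|n IHn]; rewrite ?zelt1 // expgS exprS -IHn zeltM ?groupX.
Qed.

Lemma val_zeltM H w (a : zalg F H) g : w \in 'Z(H) ->
  val (zelt H w * a) g = val a (w^-1 * g)%g.
Proof. by move=> Zw; rewrite rmorphM /= val_zelt // mul_gdelta. Qed.

Lemma zalgP H (a b : zalg F H) : {in H, forall g, val a g = val b g} -> a = b.
Proof.
move=> eq_ab; apply: val_inj; apply: galgP => g.
by have [/eq_ab|nHg] := boolP (g \in H); rewrite // !zalg_supp.
Qed.

Definition brauer_fun H v (a : zalg F H) : galg F gT :=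
  [ffun g => if g \in 'C_H[v] then val a g else 0].
(** The Brauer homomorphism Z(FH) -> Z(FC_H(v)). The truncation is always central, so the default 0
    is never taken. *)
Definition brauer H v (a : zalg F H) : zalg F 'C_H[v] := insubd 0 (brauer_fun v a).

Lemma val_brauer H v (a : zalg F H) g :
  val (brauer v a) g = if g \in 'C_H[v] then val a g else 0.
Proof.
rewrite insubdK ?ffunE //; apply/ZgalgP; split=> [x|h CHh x]; rewrite !ffunE.
  by move/negPf->.
by rewrite groupJr // zalg_conj //; case/setIP: CHh.
Qed.


Section BrauerMorphism.
Variables (H : {group gT}) (v : gT).
Local Notation br := (@brauer H v).

Lemma brauerD a b : br (a + b) = br a + br b.
Proof.
apply: zalgP => g CHg; rewrite rmorphD /= ffunE !val_brauer CHg.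
by rewrite rmorphD /= ffunE.
Qed.

Lemma brauer0 : br 0 = 0.
Proof. by apply: (addrI (br 0)); rewrite -brauerD !addr0. Qed.

Lemma brauerN a : br (- a) = - br a.
Proof. by apply/eqP; rewrite -addr_eq0 -brauerD addNr brauer0. Qed.

Hypotheses (Hv : v \in H) (p_v : p.-elt v).

Lemma center_cent1 : {subset 'Z(H) <= 'Z('C_H[v])}.
Proof.
move=> w /centerP[Hw cHw]; apply/centerP; split=> [|g /setIP[/cHw//]].
by rewrite inE Hw; apply/cent1P; exact: (cHw _ Hv).
Qed.

Lemma brauer_zelt w : w \in 'Z(H) -> br (zelt H w) = zelt 'C_H[v] w.
Proof.
by move=> Zw; apply: zalgP => g CHg; rewrite val_brauer CHg !val_zelt // center_cent1.
Qed.

Lemma brauer1 : br 1 = 1.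
Proof. by rewrite -(zelt1 H) brauer_zelt ?group1 // zelt1. Qed.

(** For g in C_H(v), conjugation by v permutes the terms of the coefficient of [a * b] at g, and by
    [sum_pgroup_fix] only the h centralizing v contribute. *)
Lemma brauerM a b : br (a * b) = br a * br b.
Proof.
apply: zalgP => g CHg; rewrite val_brauer CHg !rmorphM /= !galg_mulE.
have [Hg /cent1P cvg] := setIP CHg.
have := @sum_pgroup_fix _ _ charF _ _ <[v]>%G ('J)%act [set: gT]
  (fun h => val a h * val b (h^-1 * g)%g) p_v.
rewrite (eq_bigl predT) => [-> |h]; last by rewrite inE.
- rewrite [RHS](bigID (mem 'C_H[v])) /= [X in _ + X]big1 ?addr0 => [|h nCh]; last first.
    by rewrite val_brauer (negPf nCh) mul0r.
  rewrite (bigID (mem H)) /= [X in _ + X]big1 ?addr0 => [|h /andP[_ nHh]]; last first.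
    by rewrite zalg_supp ?mul0r.
  have fixE h : (h \in 'Fix_('J)(<[v]>))%g = (h \in 'C[v]%g) by rewrite afixJ cent_cycle.
  apply: eq_big => h; first by rewrite in_setT fixE /= in_setI andbC.
  rewrite in_setT fixE => /andP[/= cvh Hh].
  have CHh : h \in 'C_H[v] by rewrite inE Hh.
  by rewrite !val_brauer CHh groupMl ?groupV // CHg.
- by apply/subsetP=> h _; rewrite !inE; apply/subsetP=> x _; rewrite !inE.
move=> h y _ /cycleP[i ->] /=; rewrite zalg_conj ?groupX //; congr (_ * _).
rewrite -[g in LHS](_ : g ^ (v ^+ i) = g)%g; first by rewrite -conjVg -conjMg zalg_conj ?groupX.
by apply/conjg_fixP/commgP/commuteX.
Qed.

Lemma brauer_prod (zs : seq (zalg F H)) :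
  br (\prod_(z <- zs) z) = \prod_(z <- [seq br z | z <- zs]) z.
Proof.
elim: zs => [|z zs IHzs]; first by rewrite !big_nil brauer1.
by rewrite /= !big_cons brauerM IHzs.
Qed.

Lemma nilp_brauer z : nilp z -> nilp (br z).
Proof.
case=> n zn0; exists n; have -> : br z ^+ n = br (z ^+ n); last by rewrite zn0 brauer0.
by elim: n {zn0} => [|n IHn]; rewrite ?brauer1 // !exprS brauerM IHn.
Qed.

End BrauerMorphism.


Lemma subr1_exp_pchar H w c : w \in 'Z(H) ->
  (zelt H w - 1) ^+ (p ^ c) = zelt H (w ^+ (p ^ c)%N)%g - 1.
Proof.
move=> Zw; rewrite zeltX //; apply: (addIr (1 ^+ (p ^ c))).
have charZ := pchar_zalg H charF.
rewrite -exprDn_pchar ?subrK ?expr1n ?subrK //.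
by rewrite pnatX pnatE ?charZ // (pcharf_prime charF).
Qed.

(* k is annihilated by the j-th power of the augmentation ideal of FW. *)
Fixpoint Saug H W j (k : zalg F H) : Prop :=
  if j is j'.+1 then forall w, w \in W -> Saug W j' ((zelt H w - 1) * k) else k = 0.

Section Saug.
Variables (H W : {group gT}).
Implicit Types (k x : zalg F H).

Lemma Saug0 (V : {group gT}) j : Saug V j (0 : zalg F H).
Proof. by elim: j => //= j IHj w _; rewrite mulr0. Qed.

Lemma SaugM (V : {group gT}) j k x : Saug V j k -> Saug V j (x * k).
Proof.
elim: j k => [|j IHj] k /=; first by move->; rewrite mulr0.
by move=> Sk w Vw; rewrite mulrCA; apply/IHj/Sk.
Qed.

Lemma SaugD (V : {group gT}) j k1 k2 : Saug V j k1 -> Saug V j k2 -> Saug V j (k1 + k2).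
Proof.
elim: j k1 k2 => [|j IHj] k1 k2 /=; first by move=> -> ->; rewrite addr0.
by move=> S1 S2 w Ww; rewrite mulrDr; apply: IHj; [apply: S1 | apply: S2].
Qed.

Hypothesis ZW : W \subset 'Z(H).

Lemma Saug_brauer v j k : v \in H -> p.-elt v -> Saug W j k -> Saug W j (brauer v k).
Proof.
move=> Hv p_v; elim: j k => [|j IHj] k /=; first by move->; rewrite brauer0.
move=> Sk w Ww; have Zw := subsetP ZW w Ww.
by rewrite -brauer_zelt // -(brauer1 Hv) -brauerN -brauerD -brauerM //; apply/IHj/Sk.
Qed.

Variables (v : gT) (c : nat).
Hypotheses (Zv : v \in 'Z(H)) (Wv : (v ^+ (p ^ c)%N)%g \in W).

Lemma Saug_expr_annih j a k : Saug W j k -> (p ^ c * j <= a)%N ->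
  (zelt H v - 1) ^+ a * k = 0.
Proof.
elim: j a k => [|j IHj] a k /=; first by move->; rewrite mulr0.
move=> Sk; rewrite mulnS => le_a.
rewrite -(subnK (leq_trans (leq_addr _ _) le_a)) exprD -mulrA subr1_exp_pchar //.
by apply: IHj; [apply: Sk | rewrite leq_subRL // (leq_trans (leq_addr _ _) le_a)].
Qed.

(** w v^m - 1 = v^m (w - 1) + (1 + v + ... + v^(m-1)) (v - 1). The first term lowers j, hence p^c j
    by at least 1; the second raises a by 1. Either compensates for lowering i by 1. *)
Lemma Saug_cycle j a i k : Saug W j k -> (p ^ c * j <= a + i)%N ->
  Saug (W <*> <[v]>)%G i ((zelt H v - 1) ^+ a * k).
Proof.
elim: i j a k => [|i IHi] j a k Sk; first by rewrite addn0 => /(Saug_expr_annih Sk).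
case: j Sk => [|j] Sk le_j; first by rewrite [k]Sk mulr0; apply: Saug0.
have cWv : (<[v]> \subset 'C(W))%g.
  rewrite cycle_subG; apply/centP=> w /(subsetP ZW)/setIP[Hw _].
  by case/centerP: Zv => _ cv; apply: cv.
move=> w'; rewrite /= cent_joinEr // => /mulsgP[w vm Ww /cycleP[m ->] ->].
have Zw := subsetP ZW w Ww.
rewrite zeltM ?groupX // zeltX //.
have -> : zelt H w * zelt H v ^+ m - 1 = zelt H v ^+ m * (zelt H w - 1)
   + (\sum_(i < m) zelt H v ^+ i) * (zelt H v - 1).
  by rewrite [X in _ = _ + X]mulrC -subrX1; ring.
have -> : (zelt H v ^+ m * (zelt H w - 1) + (\sum_(i < m) zelt H v ^+ i) * (zelt H v - 1)) *
    ((zelt H v - 1) ^+ a * k) =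
  zelt H v ^+ m * ((zelt H v - 1) ^+ a * ((zelt H w - 1) * k)) +
  (\sum_(i < m) zelt H v ^+ i) * ((zelt H v - 1) ^+ a.+1 * k).
  by rewrite exprS; ring.
apply: SaugD; apply: SaugM.
  apply: (IHi j); first exact: Sk.
  have pc_gt0 : (0 < p ^ c)%N by rewrite expn_gt0 prime_gt0 ?(pcharf_prime charF).
  by move: le_j; rewrite mulnS; lia.
by apply: (IHi j.+1) => //; rewrite addSnnS.
Qed.

End Saug.

End Brauer.

(** * Annihilation by nilpotent central elements under a bound on defects *)

Section Annihilation.
Variables (F : fieldType) (gT : finGroupType) (p : nat).
Hypothesis charF : p \in [pchar F].
Implicit Types (H W P : {group gT}) (g v w : gT).

Local Notation p_pr := (pcharf_prime charF).

(* For Q closed under conjugation and subgroups, this says that t lies in the span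
   of the class sums whose defect groups satisfy Q. *)
Definition defect_in H (Q : {group gT} -> Prop) (t : zalg F H) :=
  forall g P, val t g != 0 -> p.-group P -> P \subset 'C_H[g] -> Q P.

Lemma defect_in_brauer H Q v (t : zalg F H) : defect_in Q t -> defect_in Q (brauer v t).
Proof.
move=> Qt g P; rewrite val_brauer; case: ifP => [_ tg pP sPC|]; last by rewrite eqxx.
apply: (Qt g) => //; apply: subset_trans sPC _.
by apply: setSI; apply: subsetIl.
Qed.

(** If P centralizes g, then P permutes the terms of the coefficient of [t * z] at g by conjugation;
    a nonzero coefficient thus requires some x centralized by P with [val t x != 0]. *)
Lemma defect_inM H Q (t z : zalg F H) : defect_in Q t -> defect_in Q (t * z).
Proof.
move=> Qt g P; rewrite rmorphM /= galg_mulE => tz_g pP sPC.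
have [sPH cPg] := subsetIP sPC.
have := @sum_pgroup_fix _ _ charF _ _ P ('J)%act [set: gT]
  (fun h => val t h * val z (h^-1 * g)%g) pP.
rewrite (eq_bigl predT) => [sumE|h]; last by rewrite inE.
have {}sumE := sumE _ _.
have [/exists_inP[x fix_x tx]|/exists_inPn no_x] :=
    boolP [exists x in 'Fix_('J)(P)%g, val t x != 0].
  have cPx : P \subset 'C_H[x].
    rewrite subsetI sPH; move: fix_x; rewrite afixJ => /centP cx.
    by apply/subsetP=> y Py; apply/cent1P/commute_sym/cx.
  exact: (Qt x).
case/eqP: tz_g; rewrite sumE.
- by apply: big1 => x /andP[_ /no_x]; rewrite negbK => /eqP->; rewrite mul0r.
- by apply/subsetP=> h _; rewrite !inE; apply/subsetP=> x _; rewrite !inE.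
move=> h y _ Py /=; have Hy := subsetP sPH y Py.
rewrite zalg_conj //; congr (_ * _).
rewrite -[g in LHS](_ : g ^ y = g)%g; first by rewrite -conjVg -conjMg zalg_conj.
by apply/conjg_fixP/commgP; have /cent1P := subsetP cPg y Py.
Qed.

(** W centralizes every element of the support of t. This bounds the order of W in the inductions
    below. *)
Lemma defect_in_center H W Q (t : zalg F H) :
  p.-group W -> W \subset 'Z(H) -> defect_in Q t -> t = 0 \/ Q W.
Proof.
move=> pW ZW Qt; have [/forallP t0|/forallPn[g tg]] := boolP [forall g, val t g == 0].
  by left; apply: zalgP => g _; rewrite (eqP (t0 g)) rmorph0 ffunE.
right; apply: (Qt g) => //; apply/subsetP=> w /(subsetP ZW)/centerP[Hw cHw].
have Hg : g \in H by apply: contraNT tg => /zalg_supp->.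
by rewrite inE Hw; apply/cent1P; apply: (cHw _ Hg).
Qed.

(** The equations make r constant on p-sections: those for w in W directly, those for the other
    p-elements v on C_H(v) through the Brauer homomorphism. *)
Lemma nilp_mul_brauer H W (z r : zalg F H) :
  W \subset 'Z(H) -> nilp z ->
  (forall w, w \in W -> (zelt F H w - 1) * r = 0) ->
  (forall v, v \in H -> p.-elt v -> v \notin W ->
     (zelt F 'C_H[v] v - 1) * brauer v r = 0) ->
  z * r = 0.
Proof.
move=> ZW nilz rW rv; apply: (mul_nilp_section_constant charF nilz) => v g Hv p_v CHg.
have [Hg /cent1P cgv] := setIP CHg.
have [Wv|nWv] := boolP (v \in W).
  have Zv := subsetP ZW v Wv.
  have zr : zelt F H v * r = r by apply/eqP; rewrite -subr_eq0 -[X in _ - X]mul1r -mulrBl rW.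
  by rewrite -{1}zr val_zeltM // mulKg.
have Zv : v \in 'Z('C_H[v]).
  apply/centerP; split=> [|x /setIP[_ /cent1P cx]]; first by rewrite inE Hv cent1id.
  exact: commute_sym.
have zr : zelt F 'C_H[v] v * brauer v r = brauer v r.
  by apply/eqP; rewrite -subr_eq0 -[X in _ - X]mul1r -mulrBl rv.
have CHv : v \in 'C_H[v] by rewrite inE Hv cent1id.
have := val_brauer v r (v * g)%g; rewrite groupM // => <-.
by rewrite -zr val_zeltM // mulKg val_brauer CHg.
Qed.

Lemma join_cycle_center H W v :
  W \subset 'Z(H) -> p.-group W -> v \in H -> p.-elt v -> v \notin W ->
  [/\ v \in 'Z('C_H[v]), W <*> <[v]> \subset 'Z('C_H[v]), p.-group (W <*> <[v]>)
    & exists2 c, (0 < c)%N & (#|W <*> <[v]>| = #|W| * p ^ c)%N /\ (v ^+ (p ^ c)%N)%g \in W].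
Proof.
move=> ZW pW Hv p_v nWv.
have Zv : v \in 'Z('C_H[v]).
  apply/centerP; split=> [|x /setIP[_ /cent1P cx]]; first by rewrite inE Hv cent1id.
  exact: commute_sym.
have ZW' : W <*> <[v]> \subset 'Z('C_H[v]).
  rewrite join_subG cycle_subG Zv andbT; apply/subsetP=> w /(subsetP ZW).
  exact: center_cent1.
have cWW : abelian (W <*> <[v]>) by apply: abelianS ZW' (center_abelian _).
have cWv : <[v]> \subset 'C(W).
  apply: subset_trans (joing_subr W _) _; apply: subset_trans cWW _.
  by apply: centS; apply: joing_subl.
have pW' : p.-group (W <*> <[v]>) by rewrite /= cent_joinEr // pgroupM pW.
have nsW : W <| W <*> <[v]> by rewrite -sub_abelian_normal // joing_subl.
have [c cW] : {c | #|W <*> <[v]> : W| = p ^ c}%N.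
  by apply: p_natP; apply: pnat_dvd (dvdn_indexg _ _) pW'.
have W'v : v \in W <*> <[v]> by rewrite -cycle_subG joing_subr.
split=> //; exists c.
  rewrite lt0n; apply: contra nWv => /eqP c0.
  move/eqP: cW; rewrite c0 expn0 indexg_eq1 => sW; exact: (subsetP sW).
split; first by rewrite -cW Lagrange // normal_sub.
have Nv : v \in 'N(W) by apply: (subsetP (normal_norm nsW)).
apply: coset_idr; first by rewrite groupX.
by rewrite morphX // -cW -card_quotient ?normal_norm // expg_cardG // mem_quotient.
Qed.

(** One nilpotent factor is spent on [nilp_mul_brauer]. The others must kill the multiple by w - 1,
    for which j drops, and over C_H(v) the multiple by v - 1, for which W grows to W<v>. *)
Theorem prod_nilp_defect_annih H W q n j (zs : seq (zalg F H)) t k :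
  p.-group W -> W \subset 'Z(H) -> defect_in (fun P => #|P| <= q)%N t ->
  Saug W j k -> (j * q <= n * #|W|)%N ->
  size zs = n -> {in zs, forall z, nilp z} ->
  (\prod_(z <- zs) z) * t * k = 0.
Proof.
have [m] := ubnP (#|gT| - #|W|); elim: m => // m IHm in H W j n zs t k *.
rewrite ltnS => le_m pW ZW Qt; elim: j n k zs => [|j IHj] n k zs.
  by move=> /= ->; rewrite mulr0.
move=> Sk le_n sz_zs nilzs.
have [->|le_Wq] := defect_in_center pW ZW Qt; first by rewrite mulr0 mul0r.
have W_gt0 := cardG_gt0 W; have q_gt0 := leq_trans W_gt0 le_Wq.
case: n => [|n] in sz_zs le_n.
  by move: le_n; rewrite mul0n leqn0 muln_eq0 (gtn_eqF q_gt0).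
case: zs sz_zs nilzs => // z zs [sz_zs] nilzs.
have nilz : nilp z by apply: nilzs; rewrite mem_head.
have {}nilzs : {in zs, forall z, nilp z} by move=> y zs_y; apply: nilzs; rewrite inE zs_y orbT.
rewrite big_cons -!mulrA.
apply: (nilp_mul_brauer ZW nilz) => [w Ww | v Hv p_v nWv].
  rewrite mulrCA [_ * (t * k)]mulrCA mulrA; apply: (IHj n) => //; first exact: Sk.
  by move: le_n; rewrite mulSn mulSnr; lia.
have [Zv ZW' pW' [c c_gt0 [cW' Wv]]] := join_cycle_center ZW pW Hv p_v nWv.
rewrite !(brauerM charF Hv p_v) mulrCA [_ * (brauer v t * _)]mulrCA mulrA (brauer_prod charF Hv p_v).
have Qt' := @defect_in_brauer _ _ v _ Qt.
have [->|/= le_W'q] := defect_in_center (W := (W <*> <[v]>)%G) pW' ZW' Qt'.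
  by rewrite mulr0 mul0r.
have ZW1 : W \subset 'Z('C_H[v]) by apply: subset_trans ZW'; apply: joing_subl.
have pc_gt0 : (0 < p ^ c)%N by rewrite expn_gt0 prime_gt0 ?p_pr.
(* [Saug_cycle] with a = 1 gives i = p^c (j + 1) - 1. Then i q <= (n + 1) |W<v>| - q, which is at
   most n |W<v>| because |W<v>| <= q. *)
apply: (IHm _ (W <*> <[v]>)%G (p ^ c * j.+1).-1 n) => //.
- have lt_WW' : (#|W| < #|W <*> <[v]>|)%N.
    by rewrite cW' ltn_Pmulr // -(expn0 p) ltn_exp2l // prime_gt1 ?p_pr.
  have le_W'g : (#|W <*> <[v]>| <= #|gT|)%N by apply: max_card.
  by apply: leq_trans le_m; apply: ltn_sub2l; rewrite // (leq_trans lt_WW').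
- have Sbk : Saug W j.+1 (brauer v k) by apply: (Saug_brauer charF).
  have := Saug_cycle charF ZW1 Zv Wv (a := 1) (i := (p ^ c * j.+1).-1) Sbk.
  by rewrite expr1; apply; rewrite add1n prednK // muln_gt0 pc_gt0.
- rewrite /= cW'; move: le_n le_W'q; rewrite /= cW'; move: (p ^ c)%N pc_gt0 => x x_gt0.
  move: (#|W|) => w le_n le_q.
  have: (x * (j.+1 * q) <= x * (n.+1 * w))%N by rewrite leq_mul2l le_n orbT.
  by have: ((x * j.+1).-1 * q + q = x * (j.+1 * q))%N; [rewrite -mulSnr prednK ?muln_gt0 ?x_gt0 // mulnA | nia].
- by rewrite size_map.
by move=> _ /mapP[y /nilzs nily ->]; apply: (nilp_brauer charF).
Qed.

End Annihilation.

(** * Fitting idempotents *)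

Section Fitting.
Variables (F : fieldType) (gT : finGroupType) (H : {group gT}).

Lemma ZgalgZ (x : F) (a : galg F gT) : a \in Zgalg H -> x *: a \in Zgalg H.
Proof.
case/ZgalgP=> suppa fixa; apply/ZgalgP; split=> [g nHg|h Hh g]; rewrite !ffunE.
  by rewrite suppa ?scaler0.
by rewrite fixa.
Qed.

(** The first N + 1 powers of t, with N = |gT|, are linearly dependent; solving a relation for its
    lowest term t^m makes t^m a multiple of t^(m+1). *)
Lemma zalg_algebraic (t : zalg F H) : exists n g, t ^+ n = t ^+ n.+1 * g.
Proof.
pose N := #|gT|; pose M : 'M[F]_(N.+1, N) := \matrix_(i, j) (val t ^+ i) (enum_val j).
have /rowV0Pn[u /sub_kermxP uM u_n0] : kermx M != 0.
  by rewrite kermx_eq0 /row_free neq_ltn ltnS rank_leq_col.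
have rel : \sum_(i < N.+1) u 0 i *: val t ^+ i = 0.
  apply: galgP => g; have /rowP/(_ (enum_rank g)) := uM.
  rewrite !mxE sum_ffunE ffunE => {2}<-; apply: eq_bigr => i _.
  by rewrite !mxE ffunE enum_rankK.
have [i0 ui0] : exists i, u 0 i != 0.
  by apply/existsP; apply: contraR u_n0 => /existsPn u0; apply/eqP/rowP=> i; rewrite mxE; apply/eqP/negPn/u0.
case: (@arg_minnP _ i0 (fun i => u 0 i != 0) (fun i => val i) ui0) => m um min_m.
pose g : galg F gT := \sum_(i < N.+1 | (m < i)%N) (- ((u 0 m)^-1 * u 0 i)) *: val t ^+ (i - m.+1).
have Zg : g \in Zgalg H.
  by apply: rpred_sum => i _; apply: ZgalgZ; apply: rpredX; apply: valP.
exists m, (Sub g Zg); apply: val_inj; rewrite rmorphM !rmorphXn /= /g mulr_sumr.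
move: rel; rewrite (bigID (fun i : 'I_N.+1 => (m < i)%N)) /= [X in _ + X](bigD1 m) /= ?ltnn //.
rewrite [X in _ + (_ + X)]big1 => [|i /andP[]]; last first.
  rewrite -leqNgt => le_im ne_im; have [->|ui] := eqVneq (u 0 i) 0; first by rewrite scale0r.
  by case/eqP: ne_im; apply: val_inj; apply/eqP; rewrite eqn_leq le_im min_m.
rewrite addr0 => /(congr1 (fun x => (u 0 m)^-1 *: x)).
rewrite scalerDr scaler0 scalerA mulVf // scale1r => /eqP; rewrite addrC addr_eq0 => /eqP->.
rewrite scaler_sumr -sumrN; apply: eq_bigr => i lt_mi.
by rewrite -scalerAr -exprD subnKC // scalerA -scaleNr.
Qed.

(** T = t^(n+1) satisfies T = T T G for G = g^(n+1), so T G is an idempotent with (1 - T G) T =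
    0. *)
Lemma fitting_idempotent (t : zalg F H) :
  exists2 s, (t * s) * (t * s) = t * s & nilp ((1 - t * s) * t).
Proof.
have [n [g tn]] := zalg_algebraic t.
have tnk k : t ^+ n.+1 = t ^+ (n.+1 + k) * g ^+ k.
  elim: k => [|k IHk]; first by rewrite addn0 expr0 mulr1.
  have def_t : t ^+ (n.+1 + k) = t ^+ k.+1 * t ^+ n by rewrite -exprD addSnnS addnC.
  by rewrite {1}IHk def_t tn [t ^+ (n.+1 + _)]exprD [g ^+ _.+1]exprS; ring.
pose T := t ^+ n.+1; pose G := g ^+ n.+1.
have TT : T = T * T * G by rewrite {1}/T (tnk n.+1) exprD.
have def_ts : t * (t ^+ n * G) = T * G by rewrite mulrA -exprS.
exists (t ^+ n * G); rewrite def_ts; first by rewrite mulrACA mulrA -TT.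
exists n.+1; rewrite exprMn exprS -mulrA [_ ^+ n * _]mulrC mulrA -/T.
suff -> : (1 - T * G) * T = 0 by rewrite mul0r.
by rewrite mulrBl mul1r mulrAC -TT subrr.
Qed.

End Fitting.

(** * Derivations from transferred cocycles *)

Section Cocycles.
Variables (F : fieldType) (gT : finGroupType) (H : {group gT}).
Local Notation FG := (galg F gT).
Local Notation "\d_ g" := (gdelta F g) (at level 8, g at level 2, format "\d_ g").
Implicit Types (a b : FG) (c : gT -> FG) (g h w : gT).

Definition supported a := forall g, g \notin H -> a g = 0.

(** A 1-cocycle of H with values in FH, on which H acts by conjugation. *)
Definition cocycle c := (forall h, h \in H -> supported (c h)) /\
  {in H &, forall g h, c (g * h)%g = c g + \d_g * c h * \d_(g^-1)}.

(** The linear map sending h in H to c(h) h; the cocycle identity is the Leibniz rule for pairs of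
    group elements. *)
Definition derivation c a : FG := \sum_(h in H) a h *: (c h * \d_h).

Lemma supported_sumE a : supported a -> a = \sum_(h in H) a h *: \d_h.
Proof.
move=> suppa; rewrite {1}[a]galg_sumE (bigID (mem H)) /= [X in _ + X]big1 ?addr0 // => g nHg.
by rewrite suppa ?scale0r.
Qed.

Lemma supportedM a b : supported a -> supported b -> supported (a * b).
Proof.
move=> suppa suppb g nHg; rewrite galg_mulE; apply: big1 => h _.
have [Hh|/suppa->] := boolP (h \in H); last by rewrite mul0r.
by rewrite suppb ?mulr0 // groupMl ?groupV.
Qed.

Lemma supported_gdelta h : h \in H -> supported \d_h.
Proof. by move=> Hh g; rewrite ffunE; have [->|//] := eqVneq g h; rewrite Hh. Qed.

Lemma supported_sum (I : finType) (P : pred I) (f : I -> FG) :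
  (forall i, P i -> supported (f i)) -> supported (\sum_(i | P i) f i).
Proof. by move=> supp g nHg; rewrite sum_ffunE big1 // => i /supp->. Qed.

Lemma supportedZ x a : supported a -> supported (x *: a).
Proof. by move=> suppa g nHg; rewrite ffunE suppa ?scaler0. Qed.

Lemma derivation_gdelta c h : h \in H -> derivation c \d_h = c h * \d_h.
Proof.
move=> Hh; rewrite /derivation (bigD1 h) //= ffunE eqxx scale1r big1 ?addr0 //.
by move=> g /andP[_ /negPf gh]; rewrite ffunE gh scale0r.
Qed.

Lemma derivationD c a b : derivation c (a + b) = derivation c a + derivation c b.
Proof. by rewrite -big_split; apply: eq_bigr => h _; rewrite ffunE scalerDl. Qed.

Section OneCocycle.
Variable c : gT -> FG.
Hypothesis cc : cocycle c.

Lemma supported_derivation a : supported (derivation c a).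
Proof.
apply: supported_sum => h Hh; apply: supportedZ; apply: supportedM.
  exact: (proj1 cc).
exact: supported_gdelta.
Qed.

Lemma derivationM a b : supported a -> supported b ->
  derivation c (a * b) = derivation c a * b + a * derivation c b.
Proof.
move=> suppa suppb.
transitivity (\sum_(h in H) \sum_(g in H) (a h * b g) *: (c (h * g)%g * \d_(h * g))).
  transitivity (\sum_(h in H) \sum_(x in H) (a h * b (h^-1 * x)%g) *: (c x * \d_x)).
    rewrite exchange_big; apply: eq_bigr => x _ /=; rewrite -scaler_suml galg_mulE.
    congr (_ *: _); rewrite (bigID (mem H)) /= [X in _ + X]big1 ?addr0 // => h nHh.
    by rewrite suppa ?mul0r.
  apply: eq_bigr => h Hh; rewrite (reindex_inj (mulgI h)); apply: eq_big => x.
    by rewrite groupMl.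
  by rewrite mulKg.
have -> : derivation c a * b =
    \sum_(h in H) \sum_(g in H) (a h * b g) *: (c h * \d_h * \d_g).
  rewrite {1}(supported_sumE suppb) mulr_suml; apply: eq_bigr => h _.
  rewrite mulr_sumr; apply: eq_bigr => g _.
  by rewrite -scalerAl -scalerAr scalerA.
have -> : a * derivation c b =
    \sum_(h in H) \sum_(g in H) (a h * b g) *: (\d_h * (c g * \d_g)).
  rewrite {1}(supported_sumE suppa) mulr_suml; apply: eq_bigr => h _.
  rewrite mulr_sumr; apply: eq_bigr => g _.
  by rewrite -scalerAl -scalerAr scalerA.
rewrite -big_split; apply: eq_bigr => h Hh /=.
rewrite -big_split; apply: eq_bigr => g Hg /=.
rewrite (proj2 cc) // -gdeltaM mulrDl scalerDr -!mulrA; congr (_ + _ *: (_ * (_ * _))).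
by rewrite mulrA gdeltaM mulVg gdelta1 mul1r.
Qed.

Lemma supported_zalg (z : zalg F H) : supported (val z).
Proof. by move=> g; apply: zalg_supp. Qed.

Lemma ZgalgPcomm a : supported a -> (forall h, h \in H -> a * \d_h = \d_h * a) -> a \in Zgalg H.
Proof.
move=> suppa ca; apply/ZgalgP; split=> // h Hh g.
have := ca h Hh => /ffunP/(_ (h * g ^ h)%g).
by rewrite mulr_gdelta mul_gdelta mulKg conjgE mulKVg mulgK => <-.
Qed.

(** When z h = h z is derived, the terms with the derivative of h cancel because z is central, so
    the derivative of z commutes with h. *)
Lemma derivation_center (z : zalg F H) : derivation c (val z) \in Zgalg H.
Proof.
apply: ZgalgPcomm (@supported_derivation _) _ => h Hh.
have cz : val z * \d_h = \d_h * val z by apply: (Zgalg_comm (valP z)); apply: supported_gdelta.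
have E1 := derivationM (supported_zalg z) (supported_gdelta Hh).
have E2 := derivationM (supported_gdelta Hh) (supported_zalg z).
have cdz : val z * derivation c \d_h = derivation c \d_h * val z.
  by apply: (Zgalg_comm (valP z)); apply: supported_derivation.
by move: E1; rewrite cz E2 cdz addrC => /addIr.
Qed.

Definition zderivation (z : zalg F H) : zalg F H :=
  Sub (derivation c (val z)) (derivation_center z).

Lemma zderivationD x y : zderivation (x + y) = zderivation x + zderivation y.
Proof. by apply: val_inj; rewrite /= derivationD. Qed.

Lemma zderivationM x y : zderivation (x * y) = zderivation x * y + x * zderivation y.
Proof. by apply: val_inj; rewrite /= derivationM //; apply: supported_zalg. Qed.

End OneCocycle.

Lemma cocycle0 : cocycle (fun=> 0).
Proof. by split=> [h _ g _|g h _ _]; rewrite ?ffunE // mulr0 mul0r addr0. Qed.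

Lemma cocycleD c1 c2 : cocycle c1 -> cocycle c2 -> cocycle (fun g => c1 g + c2 g).
Proof.
case=> supp1 cc1 [supp2 cc2]; split=> [h Hh g nHg|g h Hg Hh].
  by rewrite ffunE supp1 ?supp2 ?addr0.
by rewrite cc1 ?cc2 // mulrDr mulrDl addrACA.
Qed.

Lemma cocycleZ x c : cocycle c -> cocycle (fun g => x *: c g).
Proof.
case=> supp cc; split=> [h Hh|g h Hg Hh]; first by apply/supportedZ/supp.
by rewrite cc // scalerDr -scalerAr -scalerAl.
Qed.

Section Transfer.
Variables (P : {group gT}) (theta : gT -> F) (g : gT).
Hypotheses (sPH : P \subset H) (cPg : P \subset 'C[g]%g) (Hg : g \in H).
Hypothesis thetaM : {in P &, forall x y, theta (x * y)%g = theta x + theta y}.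

(* The transfer from P to H of the class of [theta] in H^1(P, F), multiplied by
   the P-invariant element g. *)
Definition transfer h : FG :=
  \sum_(C in rcosets P H) theta (repr C * h * (repr (C :* h))^-1)%g *: \d_(g ^ repr C).

(** The relative trace of g from P to H, which is |C_H(g) : P| times the class sum of g. *)
Definition class_transfer : FG := \sum_(C in rcosets P H) \d_(g ^ repr C).

Lemma rcosets_repr C : C \in rcosets P H -> repr C \in H /\ C = P :* repr C.
Proof.
case/rcosetsP=> x Hx ->; have := mem_repr_rcoset P x; set y := repr _ => Pxy.
split; last by rewrite (rcoset_eqP Pxy).
by move: Pxy; rewrite mem_rcoset => /(subsetP sPH); rewrite groupMr ?groupV.
Qed.

Lemma rcosets_mul C h : h \in H -> (C :* h \in rcosets P H) = (C \in rcosets P H).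
Proof.
move=> Hh; apply/idP/idP.
  case/rcosetsP=> x Hx def_C; apply/rcosetsP; exists (x * h^-1)%g; first by rewrite groupM ?groupV.
  by rewrite rcosetM -def_C -rcosetM mulgV rcoset1.
by case/rcosetsP=> x Hx ->; apply/rcosetsP; exists (x * h)%g; rewrite ?groupM ?rcosetM.
Qed.

Lemma transfer_factor C h : C \in rcosets P H -> h \in H ->
  (repr C * h * (repr (C :* h))^-1)%g \in P.
Proof.
move=> PC Hh; have [_ def_C] := rcosets_repr PC.
have PCh : C :* h \in rcosets P H by rewrite rcosets_mul.
have [_ def_Ch] := rcosets_repr PCh.
rewrite -mem_rcoset -def_Ch mem_rcoset mulgK.
by rewrite {2}def_C mem_rcoset mulgV.
Qed.

Lemma conjg_repr_mul C h : C \in rcosets P H -> h \in H ->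
  (g ^ repr (C :* h) = g ^ (repr C * h))%g.
Proof.
move=> PC Hh; set x := repr (C :* h).
have /(subsetP cPg)/cent1P cgy := transfer_factor PC Hh.
rewrite -/x in cgy; set y := (_ * _)%g in cgy.
have -> : (repr C * h = y * x)%g by rewrite mulgKV.
by rewrite conjgM; congr (_ ^ _)%g; apply/esym/conjg_fixP/commgP/commute_sym.
Qed.

(** Conjugation by x permutes the cosets, and the factor in P of x y at C is the product of those of
    x at C and of y at [C :* x]; [theta] is additive on P. *)
Lemma cocycle_transfer : cocycle transfer.
Proof.
split=> [h Hh|x y Hx Hy].
  apply: supported_sum => C /rcosets_repr[Hr _]; apply: supportedZ.
  by apply: supported_gdelta; rewrite groupJ.
have -> : \d_x * transfer y * \d_(x^-1) =
    \sum_(C in rcosets P H) theta (repr (C :* x) * y * (repr (C :* x :* y))^-1)%g *: \d_(g ^ repr C).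
  rewrite /transfer (reindex_inj (can_inj (rcosetK x))) /= mulr_sumr mulr_suml.
  apply: eq_big => C; first by rewrite rcosets_mul.
  rewrite rcosets_mul // => PC; rewrite -scalerAr -scalerAl !gdeltaM; congr (_ *: \d_ _).
  by rewrite conjg_repr_mul // conjgM conjgE mulKVg mulgK.
rewrite /transfer -big_split; apply: eq_bigr => C PC /=.
rewrite -scalerDl -thetaM ?transfer_factor ?rcosets_mul //.
by rewrite rcosetM -[in RHS]mulgA !mulgA mulgKV.
Qed.

(** A central w in P fixes every coset of P, and each factor in P equals w. *)
Lemma transfer_central w : w \in 'Z(H) -> w \in P -> transfer w = theta w *: class_transfer.
Proof.
case/centerP=> Hw cHw Pw; rewrite scaler_sumr; apply: eq_bigr => C PC.
have [Hr def_C] := rcosets_repr PC.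
have cwr : commute w (repr C) by exact: (cHw _ Hr).
have -> : C :* w = C by rewrite def_C -rcosetM -cwr rcosetM rcoset_id.
by rewrite -cwr mulgK.
Qed.

Lemma class_transfer_supp x : class_transfer x != 0 -> exists2 h, h \in H & x = (g ^ h)%g.
Proof.
have [/exists_inP[C /rcosets_repr[Hr _] /eqP->] _|/exists_inPn no_C] :=
    boolP [exists C in rcosets P H, x == g ^ repr C]%g; first by exists (repr C).
by rewrite sum_ffunE big1 ?eqxx // => C /no_C; rewrite ffunE => /negPf->.
Qed.

Lemma class_transfer_center : class_transfer \in Zgalg H.
Proof.
apply/ZgalgP; split=> [x|h Hh x].
  by apply: contraNeq => /class_transfer_supp[h Hh ->]; rewrite groupJ.
rewrite !sum_ffunE (reindex_inj (can_inj (rcosetK h))) /=.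
apply: eq_big => C; first by rewrite rcosets_mul.
rewrite rcosets_mul // => PC; rewrite !ffunE conjg_repr_mul // conjgM.
by rewrite (inj_eq (conjg_inj h)).
Qed.

Lemma class_transfer1 : class_transfer g = #|'C_H[g] : P|%g%:R.
Proof.
rewrite sum_ffunE /indexg -sum1_card natr_sum (bigID (mem (rcosets P 'C_H[g]))) /=.
rewrite [X in _ + X]big1 ?addr0 => [|C /andP[PC nC]]; last first.
  have [Hr def_C] := rcosets_repr PC.
  rewrite ffunE; case: eqP => // /esym/conjg_fixP/commgP cr; case/negP: nC.
  by rewrite def_C mem_rcosets (subsetP (mulG_subr _ _)) // inE Hr; apply/cent1P.
apply: eq_big => C.
  apply: andb_idl => /rcosetsP[x /setIP[Hx _] ->].
  by apply/rcosetsP; exists x.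
case/andP=> _ /rcosetsP[x /setIP[_ /cent1P cx] ->]; rewrite ffunE.
have := mem_repr_rcoset P x; rewrite mem_rcoset => /(subsetP cPg)/cent1P cy.
have -> : (g ^ repr (P :* x) = g)%g; last by rewrite eqxx.
apply/conjg_fixP/commgP; rewrite -[repr _](mulgKV x).
by apply: commuteM; apply: commute_sym.
Qed.

End Transfer.

End Cocycles.

(** * Cocycles from noncyclic defects, and the derivations they define *)

Section NoncyclicDefect.
Variables (F : fieldType) (gT : finGroupType) (p : nat).
Hypothesis charF : p \in [pchar F].
Implicit Types (H W P M : {group gT}) (g v w : gT).
Local Notation p_pr := (pcharf_prime charF).

(** P / M has order p and is generated by the coset of v; theta reads off the exponent of that coset
    in F. The default 0 of the choice is not reached on P. *)
Lemma exists_index_p_morphism P M v :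
  p.-group P -> maximal M P -> v \in P -> v \notin M ->
  exists theta : gT -> F, [/\ {in P &, forall x y, theta (x * y)%g = theta x + theta y},
    {in M, forall x, theta x = 0} & theta v = 1].
Proof.
move=> pP maxM Pv nMv.
have nsMP := p_maximal_normal pP maxM; have sMP := normal_sub nsMP.
have nMP := subsetP (normal_norm nsMP).
have cardQ : #|P / M|%g = p by rewrite card_quotient ?normal_norm // (p_maximal_index pP).
have ov : #[coset M v] = p.
  have := order_dvdG (mem_quotient M Pv); rewrite cardQ; case/primeP: p_pr => _ + dv.
  move/(_ _ dv)/pred2P=> [/eqP|//]; rewrite order_eq1 => /eqP/coset_idr.
  by move=> Mv; rewrite Mv ?nMP in nMv.
have genQ : (P / M = <[coset M v]>)%g.
  by apply/esym/eqP; rewrite eqEcard cycle_subG mem_quotient // cardQ -ov /=.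
pose theta y : F := (if [pick i : 'I_p | coset M y == (coset M v ^+ i)%g] is Some i then i : nat else 0%N)%:R.
have thetaE y i : coset M y = (coset M v ^+ i)%g -> theta y = i%:R.
  rewrite /theta => yi; case: pickP => [k /eqP|/(_ (Ordinal (ltn_pmod i (prime_gt0 p_pr))))].
    rewrite yi => /eqP; rewrite eq_expg_mod_order ov => /eqP ik.
    by rewrite -(GRing.natr_mod_pchar charF i) ik GRing.natr_mod_pchar.
  by rewrite yi /= -ov expg_mod_order eqxx.
have exi y : y \in P -> exists i, coset M y = (coset M v ^+ i)%g.
  by move=> Py; have := mem_quotient M Py; rewrite genQ => /cycleP.
exists theta; split=> [x y Px Py|x Mx|].
- have [[i xi] [k yk]] := (exi x Px, exi y Py).
  by rewrite (thetaE x i) // (thetaE y k) // -natrD; apply: thetaE; rewrite morphM ?nMP //= xi yk expgD.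
- by rewrite (thetaE x 0%N) // coset_id.
by rewrite (thetaE v 1%N).
Qed.

(** For v in 'Z(H), the derivation of such a cocycle vanishes on FW and sends v to a v. *)
Definition cocycle_value H W v (a : galg F gT) :=
  exists c, [/\ cocycle H c, {in W, forall w, c w = 0} & c v = a].

(** u is the class transfer of g. By its maximal order P is a Sylow p-subgroup of C_H(g), so the
    coefficient |C_H(g) : P| of u at g is nonzero in F. *)
Lemma cocycle_value_class H W v g P M :
  W \subset 'Z(H) -> v \in 'Z(H) -> g \in H -> p.-group P -> P \subset 'C_H[g] ->
  (forall P', p.-group P' -> P' \subset 'C_H[g] -> #|P'| <= #|P|)%N ->
  maximal M P -> W \subset M -> v \in P -> v \notin M ->
  exists u : zalg F H, [/\ cocycle_value H W v (val u), val u g != 0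
    & forall x, val u x != 0 -> exists2 h, h \in H & x = (g ^ h)%g].
Proof.
move=> ZW Zv Hg pP sPC maxP maxM sWM Pv nMv; have [sPH cPg] := subsetIP sPC.
have [theta [thetaM theta0 theta1]] := exists_index_p_morphism pP maxM Pv nMv.
have sMP := proper_sub (maxgroupp maxM).
exists (Sub (class_transfer F H P g) (class_transfer_center F sPH cPg Hg)); split=> /=.
- exists (transfer H P theta g); split; first exact: cocycle_transfer.
    move=> w Ww; have Mw := subsetP sWM w Ww.
    rewrite transfer_central ?(subsetP ZW) ?theta0 ?scale0r //.
    exact: (subsetP sMP).
  by rewrite transfer_central // theta1 scale1r.
- rewrite class_transfer1 // -(dvdn_pcharf charF).
  have [S sylS sPS] := Sylow_superset sPC pP.
  have [sSC pS _] := and3P sylS.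
  have -> : P :=: S by apply/eqP; rewrite eqEcard sPS maxP.
  have p'i : p^'.-nat #|'C_H[g] : S|%g by case/and3P: sylS.
  by apply/negP=> p_i; have /pnatP := p'i; move/(_ (indexg_gt0 _ _) p p_pr p_i); rewrite !inE eqxx.
by move=> x; apply: class_transfer_supp.
Qed.

(** Cocycle values are closed under linear combinations, and u is supported on the class of g, so
    subtracting a multiple of u shrinks the support of t. *)
Lemma cocycle_value_sum H W v (t : zalg F H) :
  (forall g, val t g != 0 -> exists u : zalg F H, [/\ cocycle_value H W v (val u), val u g != 0
     & forall x, val u x != 0 -> exists2 h, h \in H & x = (g ^ h)%g]) ->
  cocycle_value H W v (val t).
Proof.
have [m] := ubnP #|[pred g | val t g != 0]|; elim: m t => // m IHm t; rewrite ltnS => le_m Ht.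
have [/forallP t0|/forallPn[g tg]] := boolP [forall g, val t g == 0].
  exists (fun=> 0); split=> //; first exact: cocycle0.
  by apply: galgP => g; rewrite (eqP (t0 g)) ffunE.
have [u [[c [cc c0 cv]] ug ux]] := Ht g tg.
pose x := val t g / val u g.
have Zt' : val t - x *: val u \in Zgalg H by rewrite rpredB ?(valP t) // ZgalgZ // (valP u).
pose t' : zalg F H := Sub (val t - x *: val u) Zt'.
have t'E y : val t' y = val t y - x * val u y by rewrite /= !ffunE.
have sub_t y : val t' y != 0 -> val t y != 0.
  rewrite t'E; have [->|/ux[h Hh ->]] := eqVneq (val u y) 0; first by rewrite mulr0 subr0.
  by rewrite zalg_conj.
have [c' [cc' c'0 c'v]] : cocycle_value H W v (val t').
  apply: IHm => [|y /sub_t]; last exact: Ht.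
  apply: leq_trans le_m; apply: proper_card; apply/properP; split.
    by apply/subsetP=> y; rewrite !inE; apply: sub_t.
  by exists g; rewrite !inE // t'E /x divfK // subrr eqxx.
exists (fun g => c' g + x *: c g); split.
- by apply: cocycleD => //; apply: cocycleZ.
- by move=> w Ww; rewrite c'0 // c0 // scaler0 addr0.
by rewrite c'v cv /= subrK.
Qed.

(* If W is contained in and central in P: P / W is not cyclic. *)
Definition noncyclic_mod W P := [forall x in P, ~~ (P \subset W <*> <[x]>)].

(** P contains the central p-subgroup W<v> by maximality of its order. If x generates P modulo W<v>,
    then W<x> is proper in P, since P / W is noncyclic, and lies in a maximal subgroup M; v is not
    in M, as otherwise M would be P. *)
Lemma cocycle_value_noncyclic H W v g P :
  W \subset 'Z(H) -> v \in 'Z(H) -> p.-elt v -> p.-group W -> g \in H ->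
  p.-group P -> P \subset 'C_H[g] ->
  (forall P', p.-group P' -> P' \subset 'C_H[g] -> #|P'| <= #|P|)%N ->
  noncyclic_mod W P -> ~~ noncyclic_mod (W <*> <[v]>)%G P ->
  W <*> <[v]> \proper P /\
  exists u : zalg F H, [/\ cocycle_value H W v (val u), val u g != 0
    & forall x, val u x != 0 -> exists2 h, h \in H & x = (g ^ h)%g].
Proof.
move=> ZW Zv p_v pW Hg pP sPC maxP ncP /forall_inPn[x Px]; rewrite negbK => sPx.
have ZW' : W <*> <[v]> \subset 'Z(H) by rewrite join_subG ZW cycle_subG.
have [sPH cPg] := subsetIP sPC.
have sW'P : W <*> <[v]> \subset P.
  have cPW' : W <*> <[v]> \subset 'C(P).
    by apply: subset_trans ZW' _; rewrite subIset // centS ?orbT.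
  have pW' : p.-group (W <*> <[v]>).
    rewrite /= cent_joinEr ?pgroupM ?pW //.
    by rewrite (subset_trans (subset_trans (joing_subr W _) ZW')) // subIset // centS ?orbT // (subset_trans ZW) // subsetIl.
  have pPW' : p.-group (P <*> (W <*> <[v]>)) by rewrite /= cent_joinEr // pgroupM pP.
  have sPW' : P <*> (W <*> <[v]>) \subset 'C_H[g].
    rewrite join_subG sPC; apply/subsetP=> y /(subsetP ZW')/centerP[Hy cy].
    by rewrite inE Hy; apply/cent1P; exact: (cy _ Hg).
  have le_P := maxP (P <*> (W <*> <[v]>))%G pPW' sPW'.
  have -> : P :=: P <*> (W <*> <[v]>) by apply/eqP; rewrite eqEcard joing_subl.
  exact: joing_subr.
have sWW' : W \subset W <*> <[v]> by apply: joing_subl.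
have W'v : v \in W <*> <[v]> by rewrite -cycle_subG joing_subr.
have Pv := subsetP sW'P v W'v.
split.
  rewrite properE sW'P; apply/negP=> sPW'; have := forall_inP ncP v Pv.
  by rewrite sPW'.
have /maximal_exists[def_P|[M maxM sWxM]] : (W <*> <[x]>)%G \subset P.
- by rewrite join_subG (subset_trans sWW') // cycle_subG.
- by have := forall_inP ncP x Px; rewrite -def_P subxx.
have [sWM Mx] : W \subset M /\ x \in M.
  by move: sWxM; rewrite join_subG cycle_subG => /andP[].
apply: (cocycle_value_class ZW Zv Hg pP sPC maxP maxM sWM Pv).
apply/negP=> Mv; have /maxgroupp/proper_subn/negP[] := maxM.
by apply: subset_trans sPx _; rewrite !join_subG sWM !cycle_subG Mv.
Qed.

Lemma zderivation_zelt H c (cc : cocycle H c) w : w \in 'Z(H) ->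
  val (zderivation cc (zelt F H w)) = c w * gdelta F w.
Proof.
by move=> Zw; rewrite /= val_zelt // derivation_gdelta //; case/centerP: Zw.
Qed.

Lemma zderivation_supported H W c (cc : cocycle H c) (k : zalg F H) :
  {in W, forall w, c w = 0} -> supported W (val k) -> zderivation cc k = 0.
Proof.
move=> c0 supp; apply: val_inj; apply: big1 => h _.
by have [/c0->|/supp->] := boolP (h \in W); rewrite ?mul0r ?scaler0 ?scale0r.
Qed.

Lemma supported_zeltB1 H W w k : W \subset 'Z(H) -> w \in W ->
  supported W (val k) -> supported W (val ((zelt F H w - 1) * k)).
Proof.
move=> ZW Ww supp g nWg.
have subE (a b : galg F gT) : (a - b) g = a g - b g by rewrite !ffunE.
rewrite mulrBl mul1r rmorphB subE val_zeltM ?(subsetP ZW) //.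
by rewrite !supp ?subr0 // groupMl ?groupV.
Qed.

Lemma prod_nilp_derivation_annih H W v c d l j (zs : seq (zalg F H)) E s t k :
  W \subset 'Z(H) -> v \in 'Z(H) -> p.-group (W <*> <[v]>) ->
  (0 < c)%N -> (v ^+ (p ^ c)%N)%g \in W -> (p ^ d = l * #|W <*> <[v]>|)%N -> (p <= l)%N ->
  E * E = E -> E = s * t -> cocycle_value H W v (val t) ->
  defect_in p (fun P => #|P| <= p ^ d)%N E ->
  Saug W j k -> supported W (val k) -> {in zs, forall z, nilp z} ->
  (p + j * l * p ^ c.-1 <= size zs + 2)%N ->
  (\prod_(z <- zs) z) * ((zelt F H v - 1) * k) * E = 0.
Proof.
move=> ZW Zv pW' c_gt0 Wv def_l le_pl EE def_E [cy [cc c0 cv]] defE Sk suppk nilzs le_zs.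
have charZ := pchar_zalg H charF.
pose f := zelt F H v - 1.
have ZW' : W <*> <[v]> \subset 'Z(H) by rewrite join_subG ZW cycle_subG.
have zv1 : zelt F H v^-1 * zelt F H v = 1 by rewrite -zeltM ?groupV // mulVg zelt1.
have d1 : zderivation cc 1 = 0.
  by apply: (zderivation_supported cc c0) => g nWg; rewrite ffunE; case: eqP nWg => // ->; rewrite group1.
have dv : zderivation cc (zelt F H v) = t * zelt F H v.
  by apply: val_inj; rewrite zderivation_zelt // rmorphM /= val_zelt // cv.
(* The derivation of the cocycle sends v - 1 to t v; this factor normalizes the value to v^-1 s E t
   v = E. *)
pose del x := zelt F H v^-1 * s * E * zderivation cc x.
have delD x y : del (x + y) = del x + del y by rewrite /del zderivationD mulrDr.
have delM x y : del (x * y) = del x * y + x * del y by rewrite /del zderivationM; ring.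
have delf : del f = E.
  rewrite -[E in RHS]EE {2}def_E -[RHS]mulr1 -zv1 /del /f.
  have -> : zderivation cc (zelt F H v - 1) = t * zelt F H v.
    by apply: (addIr (zderivation cc 1)); rewrite -zderivationD subrK dv d1 addr0.
  ring.
(* Support in W is required because [del] vanishes on FW. *)
pose S b (x : zalg F H) := Saug W b x /\ supported W (val x).
pose V (x : zalg F H) := exists2 w, w \in W & x = zelt F H w - 1.
apply: (@prod_nilp_annih _ p del f E charZ delD delM EE delf c l S V c_gt0 le_pl _ _ _ _ _ _ zs j k) => //.
- have /p_natP[m vm] : p.-elt v by apply: mem_p_elt pW' _; rewrite -cycle_subG joing_subr.
  by exists (p ^ m)%N; rewrite (subr1_exp_pchar charF) // -vm expg_order zelt1 subrr.
- by move=> x [].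
- move=> b x _ [w Ww ->] [Sx suppx]; split; first exact: Sx.
  exact: supported_zeltB1.
- by move=> b x [_ suppx]; rewrite /del (zderivation_supported cc c0) ?mulr0.
- by exists (v ^+ (p ^ c)%N)%g => //; rewrite subr1_exp_pchar.
(* An x killed by v - 1 and all w - 1 lies in S_1(W<v>), so the bound for defects of order at most
   p^d = l |W<v>| applies with j = 1. *)
move=> ys x sz_ys nilys fx Wx; rewrite -mulrA [x * E]mulrC mulrA.
apply: (prod_nilp_defect_annih (W := (W <*> <[v]>)%G) (j := 1) charF pW' ZW' defE) => //.
  have cWv : <[v]> \subset 'C(W).
    rewrite cycle_subG; apply/centP=> w /(subsetP ZW)/centerP[Hw _].
    by case/centerP: Zv => _ cZv; exact: (cZv _ Hw).
  move=> w' /=; rewrite cent_joinEr // => /mulsgP[w _ Ww /cycleP[i ->] ->].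
  have Zw := subsetP ZW w Ww.
  have wx : zelt F H w * x = x.
    by apply/eqP; rewrite -subr_eq0 -[X in _ - X]mul1r -mulrBl Wx //; exists w.
  have vx : zelt F H v * x = x by apply/eqP; rewrite -subr_eq0 -[X in _ - X]mul1r -mulrBl fx.
  rewrite zeltM ?groupX // zeltX // mulrBl mul1r -mulrA.
  suff -> : zelt F H v ^+ i * x = x by rewrite wx subrr.
  by elim: (i) => [|m IHm]; rewrite ?mul1r // exprSr -mulrA vx.
by rewrite mul1n sz_ys def_l.
Qed.
End NoncyclicDefect.

(** * The sharper bound for noncyclic defects *)

Section NoncyclicBound.
Variables (F : fieldType) (gT : finGroupType) (p d : nat).
Hypothesis charF : p \in [pchar F].
Implicit Types (H W P : {group gT}) (g v w : gT).
Local Notation p_pr := (pcharf_prime charF).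
Local Notation q := (p ^ d)%N.

Definition small_or_noncyclic_mod W P := (#|P| < q)%N || (#|P| == q) && noncyclic_mod W P.

Lemma small_or_noncyclic_le W P : small_or_noncyclic_mod W P -> (#|P| <= q)%N.
Proof. by case/orP=> [/ltnW//|/andP[/eqP-> _]]. Qed.

(** W / W is cyclic, so |W| < q, and both are powers of p. *)
Lemma small_or_noncyclic_self W : p.-group W -> small_or_noncyclic_mod W W ->
  (p * #|W| <= q)%N.
Proof.
move=> /p_natP[a Wa] /orP[|/andP[_ /forall_inP/(_ 1%g (group1 W))]]; last by rewrite joing_subl.
by rewrite Wa -expnS leq_exp2l ?ltn_exp2l ?prime_gt1 ?p_pr.
Qed.

Definition defects_restriction H W (t : zalg F H) : galg F gT :=
  [ffun g => if [forall P : {group gT}, p.-group P && (P \subset 'C_H[g]) ==> small_or_noncyclic_mod W P]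
             then val t g else 0].

Lemma noncyclic_modJ W P h : h \in 'C(W) -> noncyclic_mod W (P :^ h) = noncyclic_mod W P.
Proof.
move=> cWh; have Wh : W :^ h = W by apply/normP; apply: (subsetP (cent_sub W)).
have joinJ x : (P :^ h \subset W <*> <[x ^ h]>) = (P \subset W <*> <[x]>).
  by rewrite -{1}Wh cycleJ !joingE -conjUg genJ conjSg.
apply/forall_inP/forall_inP=> ncP x Px.
  by rewrite -joinJ; apply: ncP; rewrite memJ_conjg.
by rewrite -(conjgKV h x) joinJ; apply: ncP; rewrite -mem_conjg.
Qed.

Lemma defects_restriction_center H W (t : zalg F H) :
  W \subset 'Z(H) -> defects_restriction W t \in Zgalg H.
Proof.
move=> ZW; apply/ZgalgP; split=> [g nHg|h Hh g]; rewrite !ffunE.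
  by rewrite zalg_supp ?if_same.
have cWH : {subset H <= 'C(W)}.
  move=> x Hx; apply/centP=> w /(subsetP ZW)/centerP[_ cw].
  by apply: commute_sym; exact: (cw _ Hx).
have half x y : x \in H ->
    [forall P : {group gT}, p.-group P && (P \subset 'C_H[y ^ x]) ==> small_or_noncyclic_mod W P] ->
    [forall P : {group gT}, p.-group P && (P \subset 'C_H[y]) ==> small_or_noncyclic_mod W P].
  move=> Hx /forallP H1; apply/forallP=> P; apply/implyP=> /andP[pP sPC].
  have := H1 (P :^ x)%G; rewrite /small_or_noncyclic_mod /= cardJg pgroupJ pP.
  rewrite noncyclic_modJ ?cWH // => /implyP; apply.
  by rewrite cent1J -{1}(conjGid Hx) -conjIg conjSg.
rewrite zalg_conj //; congr (if _ then _ else _); apply/idP/idP; first exact: half.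
by move=> H1; apply: (half h^-1%g); rewrite ?groupV // conjgK.
Qed.

(** The induction is that of [prod_nilp_defect_annih]. Over C_H(v) the image of e is split by an
    idempotent: one part satisfies the condition modulo W<v> and is left to the induction, the other
    is left to the derivation argument. *)
Theorem prod_nilp_noncyclic_annih H W n j (zs : seq (zalg F H)) e k :
  p.-group W -> W \subset 'Z(H) -> e * e = e ->
  defect_in p (small_or_noncyclic_mod W) e ->
  Saug W j k -> supported W (val k) -> (j * q <= n * (p * #|W|))%N ->
  size zs = (n + p.-1)%N -> {in zs, forall z, nilp z} ->
  (\prod_(z <- zs) z) * e * k = 0.
Proof.
have [m] := ubnP (#|gT| - #|W|); elim: m => // m IHm in H W j n zs e k *.
rewrite ltnS => le_m pW ZW ee Qe; elim: j n k zs => [|j IHj] n k zs.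
  by move=> /= ->; rewrite mulr0.
move=> Sk suppk le_n sz_zs nilzs.
have [->|/(small_or_noncyclic_self pW) le_pW] := defect_in_center pW ZW Qe.
  by rewrite mulr0 mul0r.
have p_gt1 := prime_gt1 p_pr; have p_gt0 := ltnW p_gt1.
have W_gt0 := cardG_gt0 W; have q_gt0 : (0 < q)%N by rewrite expn_gt0 p_gt0.
case: n => [|n] in sz_zs le_n.
  by move: le_n; rewrite mul0n leqn0 muln_eq0 (gtn_eqF q_gt0).
case: zs sz_zs nilzs => // z zs [sz_zs] nilzs.
have nilz : nilp z by apply: nilzs; rewrite mem_head.
have {}nilzs : {in zs, forall z, nilp z} by move=> y zs_y; apply: nilzs; rewrite inE zs_y orbT.
rewrite big_cons -!mulrA.
apply: (nilp_mul_brauer charF ZW nilz) => [w Ww | v Hv p_v nWv].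
  rewrite mulrCA [_ * (e * k)]mulrCA mulrA; apply: (IHj n) => //; first exact: Sk.
    exact: supported_zeltB1.
  by move: le_n; rewrite mulSn mulSnr; lia.
have [Zv ZW' pW' [c c_gt0 [cW' Wv]]] := join_cycle_center ZW pW Hv p_v nWv.
rewrite !(brauerM charF Hv p_v) mulrCA [_ * (brauer v e * _)]mulrCA mulrA (brauer_prod charF Hv p_v).
set zs' := [seq _ | _ <- _]; set k' := brauer v k; set e' := brauer v e.
have nilzs' : {in zs', forall z, nilp z}.
  by move=> _ /mapP[y /nilzs nily ->]; apply: (nilp_brauer charF).
have sz_zs' : size zs' = (n + p.-1)%N by rewrite size_map.
have Qe' := @defect_in_brauer _ _ p _ _ v _ Qe; rewrite -/e' in Qe'.
have ee' : e' * e' = e' by rewrite /e' -(brauerM charF Hv p_v) ee.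
have ZW1 : W \subset 'Z('C_H[v]) by apply: subset_trans ZW'; apply: joing_subl.
have Sk' : Saug W j.+1 k' by apply: (Saug_brauer charF).
have suppk' : supported W (val k').
  by move=> g nWg; rewrite val_brauer suppk ?if_same.
have pc_gt0 : (0 < p ^ c)%N by rewrite expn_gt0 p_gt0.
have lt_WW' : (#|W| < #|W <*> <[v]>|)%N.
  by rewrite cW' ltn_Pmulr // -(expn0 p) ltn_exp2l.
pose f := zelt F 'C_H[v] v - 1; rewrite -/f.
(* t1 is the part of [e'] on the classes that still satisfy the condition modulo W<v>. Its Fitting
   idempotent [eps] inherits the condition, and [E * t1] is nilpotent for the complementary part
   E. *)
pose t1 : zalg F 'C_H[v] := Sub (defects_restriction (W <*> <[v]>)%G e') (defects_restriction_center e' ZW').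
have Qt1 : defect_in p (small_or_noncyclic_mod (W <*> <[v]>)%G) t1.
  move=> g P; rewrite /= ffunE; case: ifP => [/forallP/(_ P)/implyP Q1 _ pP sPC|]; last by rewrite eqxx.
  by apply: Q1; rewrite pP.
have [s ss nil1] := fitting_idempotent t1.
pose eps := t1 * s; pose E := e' * (1 - eps); pose t3 := e' - t1.
have EE : E * E = E.
  transitivity ((e' * e') * (1 - eps - eps + eps * eps)); first by rewrite /E; ring.
  by rewrite ss ee' subrK.
(* E t3 = E - E t1 differs from the idempotent E by a nilpotent element, so a geometric series
   inverts it. *)
have [s3 def_E] : exists s3, E = s3 * t3.
  have [N nuN] : nilp (E * t1) by rewrite /E mulrAC -mulrA [e' * _]mulrC; apply: nilpM; rewrite mulrC.
  set nu := E * t1 in nuN; have Enu : E * nu = nu by rewrite mulrA EE.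
  have Ee' : E * e' = E by rewrite /E mulrAC ee'.
  exists (E * \sum_(i < N) nu ^+ i).
  have inv_nu : (1 - nu) * (\sum_(i < N) nu ^+ i) = 1.
    by rewrite -[1 - nu]opprB mulNr -subrX1 nuN sub0r opprK.
  have Et3 : E * t3 = E - nu by rewrite /t3 mulrBr Ee'.
  by rewrite mulrAC Et3 -[LHS]mulr1 -inv_nu mulrA mulrBr mulr1 Enu.
(* On the support of t3 some P of order q is noncyclic modulo W but cyclic modulo W<v>. *)
have key g : val t3 g != 0 -> exists P : {group gT}, #|P| = q /\ W <*> <[v]> \proper P /\
    exists u : zalg F 'C_H[v], [/\ cocycle_value 'C_H[v] W v (val u), val u g != 0
    & forall x, val u x != 0 -> exists2 h, h \in 'C_H[v] & x = (g ^ h)%g].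
  have subE (a b : galg F gT) : (a - b) g = a g - b g by rewrite !ffunE.
  rewrite /t3 rmorphB subE /= ffunE; case: ifPn => [_|/forallPn[P]]; first by rewrite subrr eqxx.
  rewrite negb_imply subr0 => /andP[/andP[pP sPC] nQ] e'g.
  have := Qe' g P e'g pP sPC; have le_q P' := fun pP' sPC' => small_or_noncyclic_le (Qe' g P' e'g pP' sPC').
  move: nQ; rewrite /small_or_noncyclic_mod negb_or => /andP[/negPf->] /=.
  rewrite negb_and => nQ /andP[/eqP Pq ncP]; move: nQ; rewrite Pq eqxx /= => nQ.
  exists P; split=> //; apply: (cocycle_value_noncyclic charF) => //.
    by apply: contraNT e'g => /zalg_supp->.
  by move=> P' pP' sPC'; rewrite Pq le_q.
(* Here p |W<v>| <= q pays for the nilpotent factor already spent. *)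
have A : (\prod_(z <- zs') z) * eps * (f * k') = 0.
  have [eps0|] := defect_in_center pW' ZW' (defect_inM charF (z := s) Qt1).
    by rewrite /eps eps0 mulr0 mul0r.
  move/(small_or_noncyclic_self pW') => le_pW'.
  apply: (IHm _ (W <*> <[v]>)%G (p ^ c * j.+1).-1 n) => //.
  - apply: leq_trans le_m; apply: ltn_sub2l => //; apply: leq_trans lt_WW' _; exact: max_card.
  - exact: defect_inM.
  - have := Saug_cycle charF ZW1 Zv Wv (a := 1) (i := (p ^ c * j.+1).-1) Sk'.
    by rewrite expr1; apply; rewrite add1n prednK // muln_gt0 pc_gt0.
  - apply: supported_zeltB1 => //; first by rewrite -cycle_subG joing_subr.
    by move=> g nW'g; apply: suppk'; apply: contra nW'g; apply/subsetP/joing_subl.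
  - have: (p ^ c * (j.+1 * q) <= p ^ c * (n.+1 * (p * #|W|)))%N by rewrite leq_mul2l le_n orbT.
    have -> : (p ^ c * (n.+1 * (p * #|W|)) = n.+1 * (p * #|W <*> <[v]>|))%N by rewrite cW'; ring.
    have: ((p ^ c * j.+1).-1 * q + q = p ^ c * (j.+1 * q))%N.
      by rewrite -mulSnr prednK ?muln_gt0 ?pc_gt0 // mulnA.
    move: le_pW' => /=; rewrite mulSn.
    move: (p * _)%N ((p ^ c * j.+1).-1 * q)%N (p ^ c * (j.+1 * q))%N => x y u; lia.
have B : (\prod_(z <- zs') z) * (f * k') * E = 0.
  have [/forallP t30|/forallPn[g /key[P [Pq [prP _]]]]] := boolP [forall g, val t3 g == 0].
    have -> : E = 0; last by rewrite mulr0.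
    rewrite def_E; suff -> : t3 = 0 by rewrite mulr0.
    by apply: zalgP => g _; rewrite (eqP (t30 g)) rmorph0 ffunE.
  (* l = p^(d-b) is at least p, because W<v> is proper in a group P of order q. *)
  have [b W'b] := p_natP pW'.
  have lt_bd : (b < d)%N by rewrite -(ltn_exp2l _ _ p_gt1) -W'b -Pq proper_card.
  have def_l : q = (p ^ (d - b) * #|W <*> <[v]>|)%N by rewrite W'b -expnD subnK // ltnW.
  apply: (prod_nilp_derivation_annih charF ZW1 Zv pW' c_gt0 Wv def_l _ EE def_E _ _ Sk' suppk' nilzs').
  - by rewrite -{1}(expn1 p) leq_exp2l // subn_gt0.
  - by apply: cocycle_value_sum => x /key[_ [_ [_]]].
  - by apply: (defect_inM charF) => x P' e'x pP' sPC'; apply: small_or_noncyclic_le (Qe' x P' e'x pP' sPC').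
  (* The p - 1 extra factors cancel the p in the requirement. The rest is the hypothesis on j and n
     divided by p |W|, since l p^(c-1) p |W| = q. *)
  rewrite sz_zs'; suff: (j.+1 * p ^ (d - b) * p ^ c.-1 <= n.+1)%N by lia.
  rewrite -(@leq_pmul2r (p * #|W|)) ?muln_gt0 ?p_gt0 //.
  have -> : (j.+1 * p ^ (d - b) * p ^ c.-1 * (p * #|W|) = j.+1 * q)%N; last by [].
  by rewrite def_l cW' -{2}(prednK c_gt0) expnS; ring.
transitivity ((\prod_(z <- zs') z) * eps * (f * k') * e' + (\prod_(z <- zs') z) * (f * k') * E).
  by rewrite /E; ring.
by rewrite A B mul0r addr0.
Qed.

End NoncyclicBound.

(** * The block and its Loewy length *)

Section GroupRingCoefficients.
Variables (F : fieldType) (gT : finGroupType) (G : {group gT}).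
Local Notation FG := (group_ring F G).
Local Notation aG := (regular_repr F G).
Implicit Types (x y : 'M[F]_#|G|) (g h : gT).

Lemma mul_scalemx2 n (X Y : 'M[F]_n) a b : (a *: X) *m (b *: Y) = a *: (b *: (X *m Y)).
Proof. by rewrite -scalemxAl -scalemxAr. Qed.

(** The coefficients are read off from the row of x at the identity in the regular
    representation. *)
Definition gcoef x : galg F gT :=
  [ffun g => if g \in G then gring_row x 0 (gring_index G g) else 0].

Lemma gcoef_linear : linear gcoef.
Proof.
move=> c x y; apply: galgP => g; rewrite !ffunE linearP !mxE.
by case: ifP => // _; rewrite scaler0 addr0.
Qed.
HB.instance Definition _ := GRing.isLinear.Build F 'M[F]_#|G| (galg F gT) *:%R gcoef gcoef_linear.

Lemma gcoef_supported x : supported G (gcoef x).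
Proof. by move=> g /negPf nGg; rewrite ffunE nGg. Qed.

Lemma gcoef_repr g : g \in G -> gcoef (aG g) = gdelta F g.
Proof.
move=> Gg; apply: galgP => h; rewrite !ffunE; case: ifP => [Gh|nGh]; last first.
  by case: eqP => // hg; rewrite hg Gg in nGh.
rewrite /gring_row !mxE gring_indexK ?group1 // mul1g eqxx /=.
by rewrite (inj_in_eq (can_in_inj (@gring_indexK _ G))).
Qed.

Lemma gcoefE (c : gT -> F) : gcoef (\sum_(g in G) c g *: aG g) = \sum_(g in G) c g *: gdelta F g.
Proof.
by rewrite linear_sum; apply: eq_bigr => g Gg; rewrite linearZ /= gcoef_repr.
Qed.

Lemma group_ringE x : (x \in FG)%MS -> x = \sum_(g in G) gcoef x g *: aG g.
Proof.
case/envelop_mxP=> c def_x; rewrite {1}def_x; apply: eq_bigr => g Gg.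
rewrite def_x gcoefE sum_ffunE (bigD1 g) //= !ffunE eqxx /GRing.scale /= mulr1.
rewrite big1 ?addr0 // => h /andP[_ hg].
by rewrite !ffunE eq_sym (negPf hg) /GRing.scale /= mulr0.
Qed.

Lemma gcoef_inj0 x : (x \in FG)%MS -> gcoef x = 0 -> x = 0.
Proof.
by move=> FGx x0; rewrite (group_ringE FGx) x0 big1 // => g _; rewrite ffunE scale0r.
Qed.

Lemma gcoefM x y : (x \in FG)%MS -> (y \in FG)%MS -> gcoef (x * y) = gcoef x * gcoef y.
Proof.
move=> FGx FGy; rewrite {1}(group_ringE FGx) {1}(group_ringE FGy) mulr_suml linear_sum.
rewrite [in RHS](supported_sumE (@gcoef_supported x)) mulr_suml; apply: eq_bigr => g Gg.
rewrite mulr_sumr linear_sum [in RHS](supported_sumE (@gcoef_supported y)) mulr_sumr.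
apply: eq_bigr => h Gh.
rewrite -scalerAl -scalerAr gdeltaM -gcoef_repr ?groupM // repr_mxM //.
move: (gcoef x g) (gcoef y h) (aG g) (aG h) => a b X Y.
have -> : (a *: X) * (b *: Y) = a *: (b *: (X *m Y)) by exact: mul_scalemx2.
by rewrite linearZ; congr (_ *: _); rewrite linearZ.
Qed.

End GroupRingCoefficients.

(** * The center of an ideal with identity, inside the center of the group algebra *)

Section CenterOfIdeal.
Variables (F : fieldType) (gT : finGroupType) (G : {group gT}).
Variables (B : 'A[F]_#|G|) (e : 'M[F]_#|G|).
Local Notation FG := (group_ring F G).
Local Notation aG := (regular_repr F G).
Local Notation ZB := ('Z(B)%MS : 'A[F]_#|G|).
Hypotheses (idB : mx_ideal FG B) (sBF : (B <= FG)%MS) (idBe : mxring_id B e).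
Implicit Types (x y : 'M[F]_#|G|).

Lemma ideal_mull x y : (x \in FG)%MS -> (y \in B)%MS -> (x *m y \in B)%MS.
Proof. by move=> FGx By; case/andP: idB => /mulsmx_subP/(_ _ _ FGx By). Qed.

Lemma ideal_mulr x y : (x \in B)%MS -> (y \in FG)%MS -> (x *m y \in B)%MS.
Proof. by move=> Bx FGy; case/andP: idB => _ /mulsmx_subP/(_ _ _ Bx FGy). Qed.

Lemma centerBP x : reflect ((x \in B)%MS /\ forall y, (y \in B)%MS -> y *m x = x *m y) (x \in ZB)%MS.
Proof.
rewrite sub_capmx; apply: (iffP andP) => [[Bx /cent_mxP cx]|[Bx cx]]; split=> //.
by apply/cent_mxP.
Qed.

Lemma centerB_group_ring x : (x \in ZB)%MS -> (x \in FG)%MS.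
Proof. by case/centerBP=> Bx _; apply: submx_trans Bx sBF. Qed.

(** x y = x (e y) = (e y) x = e (y x) = y x, as e y and y x lie in B. *)
Lemma centerB_comm x y : (x \in ZB)%MS -> (y \in FG)%MS -> x *m y = y *m x.
Proof.
case/centerBP=> Bx cx FGy; have [_ Be e1 e2] := idBe.
rewrite -{1}(e2 x Bx) -mulmxA -cx ?ideal_mulr // -mulmxA.
have By : (y *m x \in B)%MS by apply: ideal_mull.
by rewrite (e1 _ By).
Qed.

Lemma centerB_center x : (x \in ZB)%MS -> gcoef x \in Zgalg G.
Proof.
move=> Zx; have FGx := centerB_group_ring Zx.
apply: ZgalgPcomm => [|h Gh]; first exact: gcoef_supported.
have FGh : (aG h \in FG)%MS by apply: envelop_mx_id.
by rewrite -(gcoef_repr F Gh) -!gcoefM //; congr (gcoef _); apply: centerB_comm.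
Qed.

Definition zcoef x : zalg F G := insubd 0 (gcoef x).

Lemma val_zcoef x : (x \in ZB)%MS -> val (zcoef x) = gcoef x.
Proof. by move=> /centerB_center Zx; rewrite insubdK. Qed.

Lemma centerB_id : (e \in ZB)%MS.
Proof.
have [_ Be e1 e2] := idBe; apply/centerBP; split=> // y By.
by rewrite e1 ?e2.
Qed.

Lemma centerBM x y : (x \in ZB)%MS -> (y \in ZB)%MS -> (x *m y \in ZB)%MS.
Proof.
move=> Zx Zy; have [/centerBP[Bx cx] /centerBP[By cy]] := (Zx, Zy).
apply/centerBP; split=> [|w Bw]; first by rewrite ideal_mulr ?centerB_group_ring.
by rewrite mulmxA cx // -mulmxA cy // mulmxA.
Qed.

Lemma centerB_mulC x y : (x \in ZB)%MS -> (y \in ZB)%MS -> x *m y = y *m x.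
Proof. by move=> Zx /centerB_group_ring; apply: centerB_comm. Qed.

Lemma centerB_mul1 x : (x \in ZB)%MS -> x *m e = x.
Proof. by case/centerBP=> Bx _; have [_ _ _ ->] := idBe. Qed.

Lemma centerBD x y : (x \in ZB)%MS -> (y \in ZB)%MS -> (x + y \in ZB)%MS.
Proof. by move=> Zx Zy; rewrite linearD addmx_sub. Qed.

Lemma centerBZ a x : (x \in ZB)%MS -> (a *: x \in ZB)%MS.
Proof. by move=> Zx; rewrite linearZ scalemx_sub. Qed.

Lemma zcoefM x y : (x \in ZB)%MS -> (y \in ZB)%MS -> zcoef (x *m y) = zcoef x * zcoef y.
Proof.
move=> Zx Zy; apply: val_inj; rewrite val_zcoef ?centerBM // rmorphM /= !val_zcoef //.
by rewrite gcoefM ?centerB_group_ring.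
Qed.

Lemma zcoefP a x y : (x \in ZB)%MS -> (y \in ZB)%MS -> zcoef (a *: x + y) = zcoef (a *: x) + zcoef y.
Proof.
move=> Zx Zy; apply: val_inj; rewrite rmorphD /= !val_zcoef ?centerBD ?centerBZ //.
by rewrite linearD.
Qed.

Lemma zcoef_inj0 x : (x \in ZB)%MS -> zcoef x = 0 -> x = 0.
Proof.
move=> Zx x0; apply: gcoef_inj0; first exact: centerB_group_ring.
by rewrite -val_zcoef // x0 rmorph0.
Qed.

(** Multiplication by e takes the center of FG into that of B; this brings the factor s of
    [fitting_idempotent] back to B. *)
Lemma zcoef_lift (s : zalg F G) : exists2 x, (x \in ZB)%MS & zcoef x = s * zcoef e.
Proof.
pose y : 'M[F]_#|G| := \sum_(g in G) (val s g : F) *: aG g.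
have FGy : (y \in FG)%MS by apply/envelop_mxP; exists (val s).
have [_ Be e1 e2] := idBe.
have ys : gcoef y = val s by rewrite gcoefE -supported_sumE //; apply: supported_zalg.
have cy w : (w \in FG)%MS -> w *m y = y *m w.
  move=> FGw; apply/eqP; rewrite -subr_eq0; apply/eqP; apply: gcoef_inj0.
    have FGwy : (w *m y \in FG)%MS by apply: envelop_mxM.
    have FGyw : (y *m w \in FG)%MS by apply: envelop_mxM.
    by rewrite linearB /= addmx_sub ?eqmx_opp.
  rewrite linearB /= [gcoef (w *m y)]gcoefM // [gcoef (y *m w)]gcoefM // ys.
  by rewrite (Zgalg_comm (valP s)) ?subrr //; apply: gcoef_supported.
have Zye : (y *m e \in ZB)%MS.
  apply/centerBP; split=> [|w Bw]; first exact: ideal_mull.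
  have FGw : (w \in FG)%MS by apply: submx_trans Bw sBF.
  by rewrite mulmxA cy // -!mulmxA e2 ?e1.
exists (y *m e) => //; apply: val_inj; rewrite val_zcoef // rmorphM /= val_zcoef ?centerB_id //.
by rewrite gcoefM ?ys //; apply: submx_trans Be sBF.
Qed.

End CenterOfIdeal.

(** * The support of a relative trace *)

Section TraceIdempotent.
Variables (F : fieldType) (gT : finGroupType) (p d : nat) (G D : {group gT}).
Hypotheses (charF : p \in [pchar F]) (sDG : D \subset G).
Hypotheses (oD : #|D| = (p ^ d)%N) (ncD : ~~ cyclic D).
Local Notation FG := (group_ring F G).
Local Notation aG := (regular_repr F G).
Implicit Types (a : 'M[F]_#|G|) (x g : gT).

Lemma gcoef_fixed a x g : fixed_by D a -> x \in D -> gcoef a (x * g * x^-1)%g = gcoef a g.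
Proof.
case=> FGa ca Dx; have Gx := subsetP sDG x Dx.
have FGx : (aG x \in FG)%MS by apply: envelop_mx_id.
have: gcoef a * gdelta F x = gdelta F x * gcoef a.
  by rewrite -(gcoef_repr F Gx) -!gcoefM //; congr (gcoef _); exact: (ca x Dx).
by move/ffunP/(_ (x * g)%g); rewrite mulr_gdelta mul_gdelta mulKg.
Qed.

Lemma gcoef_trace a g : fixed_by D a ->
  gcoef (relative_trace D a) g =
    \sum_(C in rcosets D G) gcoef a (repr C * g * (repr C)^-1)%g.
Proof.
case=> FGa ca; rewrite linear_sum sum_ffunE; apply: eq_bigr => C DC.
have [Gr _] := rcosets_repr sDG DC; have Gr' : (repr C)^-1%g \in G by rewrite groupV.
have FGx y : y \in G -> (aG y \in FG)%MS by apply: envelop_mx_id.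
rewrite [LHS](_ : _ = (gcoef ((aG (repr C)^-1%g * a) * aG (repr C))) g) //.
rewrite gcoefM ?envelop_mxM ?FGx // gcoefM ?FGx // !gcoef_repr //.
by rewrite mulr_gdelta mul_gdelta invgK mulgA.
Qed.

(** P permutes the cosets of D by right multiplication, and the terms of the coefficient at g are
    constant on orbits. Hence some coset C is fixed by P, and P lies in the conjugate of D by
    [repr C]. *)
Lemma trace_defect a g (P : {group gT}) :
  fixed_by D a -> gcoef (relative_trace D a) g != 0 -> p.-group P -> P \subset 'C_G[g] ->
  exists2 h, h \in G & P \subset D :^ h.
Proof.
move=> fix_a tr_g pP sPC; have [sPG cPg] := subsetIP sPC.
have [/exists_inP[C DC /forall_inP fixC]|/exists_inPn noC] :=
    boolP [exists C in rcosets D G, [forall y in P, C :* y == C]].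
  have [Gr _] := rcosets_repr sDG DC; exists (repr C) => //.
  apply/subsetP=> y Py; have := transfer_factor sDG DC (subsetP sPG y Py).
  by rewrite (eqP (fixC y Py)) mem_conjg conjgE invgK mulgA.
case/eqP: tr_g; rewrite gcoef_trace //.
rewrite (@sum_pgroup_fix _ _ charF _ _ P ('Rs)%act) //.
- apply: big1 => C /andP[DC /afixP fixC]; case/negP: (noC C DC).
  by apply/forall_inP=> y Py; rewrite -rcosetE; apply/eqP/fixC.
- apply/subsetP=> y Py; rewrite !inE; apply/subsetP=> C DC; rewrite inE /= rcosetE.
  by rewrite rcosets_mul // (subsetP sPG).
move=> C y DC Py /=; have Gy := subsetP sPG y Py; rewrite rcosetE.
have [x Dx ->] : exists2 x, x \in D & repr (C :* y) = (x * (repr C * y))%g.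
  exists (repr C * y * (repr (C :* y))^-1)^-1%g; first by rewrite groupV (transfer_factor sDG).
  by rewrite invMg invgK mulgKV.
rewrite -[RHS](gcoef_fixed (repr C * g * (repr C)^-1)%g fix_a Dx).
congr (gcoef a _); rewrite !invMg !mulgA; congr (_ * _ * _)%g.
have /cent1P cyg := subsetP cPg y Py.
by rewrite -[(_ * y * g)%g]mulgA cyg !mulgA mulgK.
Qed.

Lemma trace_small_or_noncyclic a g (P : {group gT}) :
  fixed_by D a -> gcoef (relative_trace D a) g != 0 -> p.-group P -> P \subset 'C_G[g] ->
  small_or_noncyclic_mod p d 1%G P.
Proof.
move=> fix_a tr_g pP sPC; have [h Gh sPD] := trace_defect fix_a tr_g pP sPC.
have := subset_leq_card sPD; rewrite cardJg oD leq_eqVlt /small_or_noncyclic_mod.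
case/orP=> [/eqP oP|->//]; rewrite oP ltnn eqxx /=.
apply/forall_inP=> x Px; apply: contra ncD; rewrite joing1G => sPx.
have defD : P :=: D :^ h by apply/eqP; rewrite eqEcard sPD cardJg oD oP /=.
have cP : cyclic P by apply: cyclicS sPx (cycle_cyclic x).
by rewrite -(cyclicJ D h) -defD.
Qed.

End TraceIdempotent.

(** * Existence of subspaces, maximal left ideals and the Loewy length *)

Lemma exists_submx (F : fieldType) m (S : 'rV[F]_m -> Prop) :
  S 0 -> (forall a u v, S u -> S v -> S (a *: u + v)) ->
  exists J : 'M[F]_m, forall u, (u <= J)%MS <-> S u.
Proof.
move=> S0 SD.
(* k bounds the codimension of J; a vector of S outside J is adjoined as long as there is one. *)
suff H k (J : 'M[F]_m) : (forall u, (u <= J)%MS -> S u) -> (m <= \rank J + k)%N ->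
    exists J' : 'M[F]_m, forall u, (u <= J')%MS <-> S u.
  by apply: (H m 0) => [u|]; rewrite ?submx0 ?leq_addl // => /eqP->.
elim: k J => [|k IHk] J SJ le_m.
  exists J => u; split=> [|_]; first exact: SJ.
  by apply: submx_full; rewrite /row_full eqn_leq rank_leq_col -[X in (_ <= X)%N]addn0.
have [max_J|] := classic (forall u, S u -> (u <= J)%MS).
  by exists J => u; split=> [/SJ|/max_J].
move/not_all_ex_not=> [u Hu]; have [Su /negP nJu] := imply_to_and _ _ Hu.
apply: (IHk (J + u)%MS).
  move=> w /sub_addsmxP[[a b] /= ->]; rewrite addrC [b]mx11_scalar mul_scalar_mx.
  by apply: SD => //; apply: SJ; apply: submxMl.
rewrite (leq_trans le_m) // addnS -addSn leq_add2r.
rewrite ltn_neqAle mxrankS ?addsmxSl // andbT; apply: contra nJu => /eqP rJ.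
have: (J + u <= J)%MS by rewrite -(geq_leqif (mxrank_leqif_sup (addsmxSl J u))) rJ.
by apply: submx_trans; apply: addsmxSr.
Qed.

Lemma exists_maximal_left_ideal (F : fieldType) n (A M : 'A[F]_n) :
  left_mx_ideal A M -> (M < A)%MS -> exists2 M', maximal_left_ideal A M' & (M <= M')%MS.
Proof.
have [k] := ubnP (n * n - \rank M)%N; elim: k M => // k IHk M; rewrite ltnS => le_k idM ltM.
have [maxM|] := classic (forall N : 'A[F]_n, left_mx_ideal A N -> (M <= N)%MS -> (N < A)%MS -> (N <= M)%MS).
  by exists M.
move/not_all_ex_not=> [N HN]; have [idN {}HN] := imply_to_and _ _ HN.
have [sMN {}HN] := imply_to_and _ _ HN; have [ltN /negP nNM] := imply_to_and _ _ HN.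
have ltMN : (M < N)%MS by rewrite ltmxE sMN; apply/negP.
have [|M' maxM' sNM'] := IHk N _ idN ltN; last by exists M' => //; apply: submx_trans sMN sNM'.
move: ltMN ltN; rewrite !ltmxErank => /andP[_ lt1] /andP[_ lt2].
apply: leq_trans le_k; apply: ltn_sub2l => //.
exact: leq_trans lt1 (rank_leq_col _).
Qed.

Lemma exists_loewy_length (F : fieldType) n (A J : 'A[F]_n) N :
  is_jacobson_radical A J -> ideal_exp A J N = 0 ->
  exists2 l, is_loewy_length A l & (l <= N)%N.
Proof.
move=> radJ JN0; have exP : exists k, ideal_exp A J k == 0 by exists N; apply/eqP.
exists (ex_minn exP); case: ex_minnP => l /eqP l0 min_l.
  by exists J => //; split=> // k /eqP; apply: min_l.
by apply: min_l; apply/eqP.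
Qed.

(** The row [mxvec x] encodes the line spanned by x, so the product encodes the principal left ideal
    A x. *)
Lemma mem_mulsmx_vec (F : fieldType) n (A : 'A[F]_n) (x w : 'M[F]_n) :
  (w \in (A * mxvec x)%MS)%MS -> exists2 y, (y \in A)%MS & w = y *m x.
Proof.
case/mulsmxP=> A1 A1A [A2 A2x ->].
suff /fin_all_exists[c Dc] i : exists c, A2 i = c *: x.
  exists (\sum_i c i *: A1 i); last first.
    by rewrite mulmx_suml; apply: eq_bigr => i _; rewrite Dc -scalemxAr -scalemxAl.
  by rewrite linear_sum summx_sub // => i _; rewrite linearZ /= scalemx_sub ?A1A.
have /sub_rVP[c Dc] := A2x i; exists c.
by apply: (can_inj mxvecK); rewrite Dc linearZ.
Qed.

(** * The Jacobson radical of the center of the ideal as its nilradical *)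

Section JacobsonRadical.
Variables (F : fieldType) (gT : finGroupType) (G : {group gT}).
Variables (B : 'A[F]_#|G|) (e : 'M[F]_#|G|).
Local Notation FG := (group_ring F G).
Local Notation ZB := ('Z(B)%MS : 'A[F]_#|G|).
Hypotheses (idB : mx_ideal FG B) (sBF : (B <= FG)%MS) (idBe : mxring_id B e).
Implicit Types (x y : 'M[F]_#|G|).
Local Notation zc := (@zcoef F gT G).
Local Notation zM := (zcoefM idB sBF idBe).
Local Notation ZBe := (centerB_id idBe).
Local Notation ZBM := (centerBM idB sBF).

Lemma zcoef_id_mul x : (x \in ZB)%MS -> zc e * zc x = zc x.
Proof.
by move=> Zx; rewrite -zM ?ZBe // (centerB_mulC idB sBF idBe) ?ZBe // (centerB_mul1 idBe).
Qed.

Lemma zcoef0 : zc 0 = 0.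
Proof. by apply: val_inj; rewrite (val_zcoef idB sBF idBe) ?mem0mx // linear0. Qed.

Lemma zcoef_inj x y : (x \in ZB)%MS -> (y \in ZB)%MS -> zc x = zc y -> x = y.
Proof.
move=> Zx Zy eq_xy; have ZN : (- y \in ZB)%MS by rewrite -scaleN1r centerBZ.
apply/eqP; rewrite -subr_eq0; apply/eqP; apply: (zcoef_inj0 idB sBF idBe).
  by rewrite centerBD.
rewrite -[- y]scaleN1r addrC (zcoefP idB sBF idBe) // eq_xy.
by rewrite -(zcoefP idB sBF idBe) // scaleN1r addNr zcoef0.
Qed.

Lemma exists_nilradical :
  exists J : 'A[F]_#|G|, forall x, (x \in J)%MS <-> (x \in ZB)%MS /\ nilp (zc x).
Proof.
pose S (u : 'rV[F]_(#|G| * #|G|)) := (vec_mx u \in ZB)%MS /\ nilp (zc (vec_mx u)).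
have [|a u v [Zu nu] [Zv nv]|J HJ] := @exists_submx F _ S.
- rewrite /S linear0 mem0mx; split=> //; exists 1%N.
  by rewrite expr1 zcoef0.
- rewrite /S linearP; have Zau : (a *: vec_mx u \in ZB)%MS by rewrite centerBZ.
  split; first by rewrite centerBD.
  rewrite (zcoefP idB sBF idBe) //; apply: nilpD => //.
  have -> : zc (a *: vec_mx u) = zc (a *: e) * zc (vec_mx u).
    rewrite -zM ?centerBZ ?ZBe // -scalemxAl (centerB_mulC idB sBF idBe) ?ZBe //.
    by rewrite (centerB_mul1 idBe).
  by rewrite mulrC; apply: nilpM.
by exists J => x; have := HJ (mxvec x); rewrite /S mxvecK.
Qed.

(** Otherwise M and x generate the whole center, so e = m + w with m in M and w a multiple of x,
    hence nilpotent. All e - w^k with k > 0 lie in M, hence so does e. *)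
Lemma nilp_mem_maximal M x : maximal_left_ideal ZB M -> (x \in ZB)%MS -> nilp (zc x) -> (x \in M)%MS.
Proof.
case=> idM ltM maxM Zx [n xn0]; apply/negPn/negP=> nMx.
have sMZ : (M <= ZB)%MS by apply: ltmxW.
pose N : 'A[F]_#|G| := (M + (ZB * mxvec x)%MS)%MS.
have memM y z : (y \in ZB)%MS -> (z \in M)%MS -> (y *m z \in M)%MS.
  by move=> Zy Mz; move/mulsmx_subP: idM; apply.
have idN : left_mx_ideal ZB N.
  apply/mulsmx_subP=> y z Zy /memmx_addsP[[z1 z2] [/= Mz1 z2x ->]].
  rewrite mulmxDr linearD addmx_sub //.
    by apply: submx_trans (addsmxSl _ _); apply: memM.
  apply: submx_trans (addsmxSr _ _).
  have [w Zw ->] := mem_mulsmx_vec z2x; rewrite mulmxA.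
  by apply: mem_mulsmx; [apply: ZBM | rewrite submx_refl].
have sNZ : (N <= ZB)%MS.
  rewrite addsmx_sub sMZ; apply/mulsmx_subP=> y z Zy /sub_rVP[c Dc].
  have -> : z = c *: x by apply: (can_inj mxvecK); rewrite Dc linearZ.
  by apply: ZBM; rewrite // centerBZ.
have Nx : (x \in N)%MS.
  apply: submx_trans (addsmxSr _ _).
  have ex : e *m x = x by rewrite (centerB_mulC idB sBF idBe) ?ZBe // (centerB_mul1 idBe).
  by rewrite -{1}ex; apply: mem_mulsmx; [apply: ZBe | rewrite submx_refl].
have [ltN|] := boolP (N < ZB)%MS.
  by case/negP: nMx; apply: submx_trans Nx (maxM N idN (addsmxSl _ _) ltN).
rewrite ltmxE sNZ /= negbK => sZN.
have /memmx_addsP[[m w] [/= Mm wx def_e]] := submx_trans ZBe sZN.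
have [y Zy def_w] := mem_mulsmx_vec wx.
have Zw : (w \in ZB)%MS by rewrite def_w ZBM.
have ZM z : (z \in M)%MS -> (z \in ZB)%MS by move=> Mz; apply: submx_trans Mz sMZ.
have pow k : exists2 t, (t \in ZB)%MS & zc t = zc w ^+ k.+1 /\ (e - t \in M)%MS.
  elim: k => [|k [t Zt [def_t Met]]]; first by exists w; rewrite // expr1 def_e addrK.
  exists (t *m w); rewrite ?ZBM // zM // def_t -exprSr; split=> //.
  have -> : e - t *m w = (e - t) + t *m (e - w).
    by rewrite mulmxBr (centerB_mul1 idBe) // addrA subrK.
  by rewrite linearD addmx_sub // def_e addrK memM.
have [t Zt [t0 Met]] := pow n.
have {}t0 : t = 0.
  apply: (zcoef_inj0 idB sBF idBe Zt).
  by rewrite t0 def_w zM // exprS exprMn xn0 !mulr0.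
rewrite t0 subr0 in Met; move: ltM; rewrite ltmxE => /andP[_ /negP[]].
apply/memmx_subP=> z Zz; rewrite -(centerB_mul1 idBe Zz); exact: memM.
Qed.

(** If the Fitting idempotent f of x is nonzero, e - f generates a proper ideal, since f annihilates
    it. A maximal ideal above it contains e - f and also f, a multiple of x, hence e. *)
Lemma mem_maximal_nilp x : (x \in ZB)%MS ->
  (forall M, maximal_left_ideal ZB M -> (x \in M)%MS) -> nilp (zc x).
Proof.
move=> Zx maxx; have [s ss nil1] := fitting_idempotent (zc x).
have [y Zy def_y] := zcoef_lift idB sBF idBe s.
pose f := x *m y; have Zf : (f \in ZB)%MS by apply: ZBM.
have def_f : zc f = zc x * s by rewrite zM // def_y [s * _]mulrC mulrA [zc x * _]mulrC zcoef_id_mul.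
have ff : f *m f = f by apply: zcoef_inj; rewrite ?ZBM // zM // def_f.
have [f0|f_neq0] := eqVneq f 0.
  by move: nil1; rewrite -def_f f0 zcoef0 subr0 mul1r.
pose M0 : 'A[F]_#|G| := (ZB * mxvec (e - f))%MS.
have Zef : (e - f \in ZB)%MS by rewrite -scaleN1r centerBD ?centerBZ ?ZBe.
have idM0 : left_mx_ideal ZB M0.
  rewrite /left_mx_ideal mulsmxA mulsmxS //; apply/mulsmx_subP=> u v; exact: ZBM.
have M0f z : (z \in M0)%MS -> z *m f = 0.
  case/mem_mulsmx_vec=> u _ ->; rewrite -mulmxA mulmxBl ff.
  by rewrite (centerB_mulC idB sBF idBe ZBe Zf) (centerB_mul1 idBe) // subrr mulmx0.
have ltM0 : (M0 < ZB)%MS.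
  rewrite ltmxE; apply/andP; split.
    apply/mulsmx_subP=> u v Zu /sub_rVP[c Dc].
    have -> : v = c *: (e - f) by apply: (can_inj mxvecK); rewrite Dc linearZ.
    by apply: ZBM; rewrite // centerBZ.
  apply/negP=> sZM0; case/eqP: f_neq0.
  rewrite -(centerB_mul1 idBe Zf) (centerB_mulC idB sBF idBe Zf ZBe).
  by apply: M0f; apply: submx_trans ZBe sZM0.
have [M maxM sM0M] := exists_maximal_left_ideal idM0 ltM0.
have [idM ltM _] := maxM.
have memM z w : (z \in ZB)%MS -> (w \in M)%MS -> (z *m w \in M)%MS.
  by move=> Zz Mw; move/mulsmx_subP: idM; apply.
have Mf : (f \in M)%MS by rewrite /f (centerB_mulC idB sBF idBe) // memM // maxx.
have Mef : (e - f \in M)%MS.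
  apply: submx_trans sM0M; rewrite -(centerB_mul1 idBe Zef) (centerB_mulC idB sBF idBe Zef ZBe).
  by apply: mem_mulsmx; [apply: ZBe | rewrite submx_refl].
have Me : (e \in M)%MS by rewrite -(subrK f e) linearD addmx_sub.
move: ltM; rewrite ltmxE => /andP[_ /negP[]].
apply/memmx_subP=> z Zz; rewrite -(centerB_mul1 idBe Zz); exact: memM.
Qed.


Lemma ideal_exp_eq0 J N :
  (forall x, (x \in J)%MS <-> (x \in ZB)%MS /\ nilp (zc x)) ->
  (forall zs : seq (zalg F G), size zs = N -> {in zs, forall z, nilp z} ->
     (\prod_(z <- zs) z) * zc e = 0) ->
  ideal_exp ZB J N = 0.
Proof.
move=> HJ bound.
(* The induction on k moves the last factor of an element of J^k into [zs]. *)
suff H k w (zs : seq (zalg F G)) : (w \in ideal_exp ZB J k)%MS -> (size zs + k = N)%N ->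
    {in zs, forall z, nilp z} -> (w \in ZB)%MS /\ (\prod_(z <- zs) z) * zc w = 0.
  apply/eqP; rewrite -submx0; apply/memmx_subP=> w Iw.
  have [Zw w0] := H N w [::] Iw (add0n N) (fun z Hz => False_ind _ (Bool.diff_false_true Hz)).
  rewrite big_nil mul1r in w0.
  by rewrite (zcoef_inj0 idB sBF idBe Zw w0) mem0mx.
elim: k w zs => [|k IHk] w zs /=.
  rewrite addn0 => Zw sz nil; split=> //.
  by rewrite -(zcoef_id_mul Zw) mulrA bound ?mul0r.
case/mulsmxP=> A1 IA1 [A2 JA2 ->] sz nil.
have step i : (A1 i *m A2 i \in ZB)%MS /\ (\prod_(z <- zs) z) * zc (A1 i *m A2 i) = 0.
  have [Z2 nil2] := (HJ _).1 (JA2 i).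
  have [|z|Z1 E1] := IHk _ (zc (A2 i) :: zs) (IA1 i); first by rewrite -sz addSnnS.
    by rewrite inE => /predU1P[->|/nil].
  by rewrite ZBM // zM //; split=> //; rewrite -E1 big_cons; ring.
move: (\prod_(z <- zs) z) step => P step.
elim/big_rec: _ => [|i w' _ [Zw' E']]; first by rewrite mem0mx zcoef0 mulr0.
have [Zi Ei] := step i; split; first by rewrite centerBD.
by rewrite -[A1 i *m A2 i]scale1r (zcoefP idB sBF idBe) // scale1r mulrDr Ei E' addr0.
Qed.

End JacobsonRadical.


(* The Loewy length of the center of a block *)
Local Close Scope ring_scope.
Local Close Scope group_scope.

Theorem corollary4 (F : closedFieldType) (p : nat) (gT : finGroupType)
    (G : {group gT}) (B : 'A[F]_#|G|) (D : {group gT}) (d : nat)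
    (charF : p \in [pchar F]%R)
    (blockB : is_block B)
    (defectD : is_defect_group B D)
    (ncycD : ~~ cyclic D)
    (orderD : #|D| = p ^ d) :
  exists2 l : nat,
    is_loewy_length ('Z(B)%MS : 'A[F]_#|G|) l & l <= p ^ (d - 1) + p - 1.
Proof.
case: defectD => [[sDG [a fix_a idBe]] _]; case: blockB => [[idB [B' [_ _ defFG]]] _].
set e := relative_trace D a in idBe.
have p_pr := pcharf_prime charF; have p_gt0 := prime_gt0 p_pr.
have sBF : (B <= group_ring F G)%MS by rewrite -defFG addsmxSl.
have [J HJ] := exists_nilradical idB sBF idBe.
have ZBe := centerB_id idBe.
have d_gt0 : (0 < d)%N.
  by rewrite lt0n; apply: contra ncycD => /eqP d0; rewrite (card1_trivg (eqP _)) ?cyclic1 // orderD d0.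
(* For W = 1 and j = 1, the least n with j q <= n p |W| is p^(d-1); p - 1 further factors are
   added. *)
pose N := (p ^ (d - 1) + p.-1)%N.
have JN0 : (ideal_exp ('Z(B)%MS : 'A[F]_#|G|) J N = 0)%R.
  apply: (ideal_exp_eq0 idB sBF idBe HJ) => zs sz nil.
  (* The appended 1 is the element k of S_1(1). *)
  rewrite -[LHS]mulr1.
  apply: (prod_nilp_noncyclic_annih (d := d) (W := 1%G) (n := (p ^ (d - 1))%N) (j := 1) charF) => //.
  - exact: pgroup1.
  - exact: sub1G.
  - by rewrite (zcoef_id_mul idB sBF idBe ZBe).
  - move=> g P; rewrite (val_zcoef idB sBF idBe) // => eg pP sPC.
    exact: (trace_small_or_noncyclic charF sDG orderD ncycD fix_a eg pP sPC).
  - by move=> w /set1gP-> /=; rewrite zelt1 subrr mul0r.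
  - by move=> g; rewrite inE => g1; rewrite ffunE (negPf g1).
  by rewrite mul1n cards1 muln1 -expnSr subn1 prednK.
rewrite -addnBA // [p - 1]subn1; apply: (exists_loewy_length (J := J)) => // x.
split=> [/HJ[Zx nilx]|[Zx maxx]].
  by split=> // M maxM; apply: (nilp_mem_maximal idB sBF idBe maxM).
by apply/HJ; split=> //; apply: (mem_maximal_nilp idB sBF idBe).
Qed.
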